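(* Consider the VRA-DGT iteration described in the context, under assumptions (A1), (A2) and (A3) with $p_1=2$. Let $\gamma_k=c_1\alpha_k$ with $c_1>0$, and put $$\delta^D=\min\left\{\mu,\ \frac{\tilde\gamma\eta_w}{\alpha_1}-\frac{2}{c_1\eta_w},\ c_1\eta_w-\frac{8L^2}{n}\right\},\qquad \tilde\delta^D=\left(\frac{10L^2}{\tilde\gamma\eta_w}+30L^2\right)\max\left\{1,\|\mathbf W-\mathbf I\|^2c_1^2\right\},$$ $$\tau^D=\left[\left(\frac{10L^2}{\tilde\gamma\eta_w}+30L^2\right)c_1^2+\frac{2c_1}{\eta_w}+\frac{10c_1^2}{n}\right]c_x+10\tilde\gamma\left(\frac{\alpha_1L^2}{\eta_w}+\frac{\tilde\gamma}{n}\right)c_s,\qquad \tilde\tau^D=\frac{4\tilde\gamma}{\eta_w}\left(c_s+n\sigma_\zeta^2\right),$$ where $c_s,c_x$ are the constants, described in the context, with $\mathbb E[\|\mathbf e^s_k\|^2]\le c_s\beta_k$ and $\mathbb E[\|\mathbf e^x_k\|^2]\le c_x\beta_k$. Let $\mathcal L^D_k:=\|\mathbf y_k-\bar{\mathbf y}_k\|^2+\|\mathbf x_k-\bar{\mathbf x}_k\|^2+(f(\bar x_k)-f^* )$. Assume $\tilde\gamma\in(0,1]$ and $\delta^D>0$. Then: (i) if $\alpha_k\asymp\frac1{k^b}$ is nonincreasing and $\beta_k\le c_2\alpha_k$, with $b\in(1/2,1)$ and $c_2>0$, then $\mathbb E[\mathcal L^D_{k+1}]=\mathcal O\left(\frac1{k^b}\right)$;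 (ii) if $\alpha_k=\frac{a_2}{k+a_1}$ and $\beta_k=\frac{c_2a_2}{k+a_1}$ with $a_1>0$, $a_2>\frac2{\delta^D}$ and $c_2a_2\in[1,a_1+1)$, then $\mathbb E[\mathcal L^D_{k+1}]=\mathcal O\left(\frac1k\right)$; (iii) if $\alpha_k\equiv\tilde\alpha$, and either $\beta_k\asymp\frac1{k^b}$ with $b\in(1/2,1)$ or $\beta_k=\frac{a_2}{k+a_1}$ with $a_1\ge0$, $a_2\in[1,a_1+1)$, and moreover $$\frac{4-\delta^D\tilde\alpha}{4-2\delta^D\tilde\alpha}\ge\sup_{k\ge1}\frac{\beta_k^2}{\beta_{k+1}^2},\qquad \tilde\alpha\le\min\left\{1,\ \frac{1}{\left(\frac{10L^2}{\tilde\gamma\eta_w}+30L^2\right)n},\ \frac{\delta^D}{2\tilde\delta^D}\right\},$$ then $$\mathbb E[\mathcal L^D_{k+1}]\le\left(1-\frac{\delta^D\tilde\alpha}{2}\right)^k\mathbb E[\mathcal L^D_1]+\frac{4\tau^D}{\delta^D}\beta_k+\frac{4\tilde\tau^D}{\delta^D\tilde\alpha}\beta_k^2 .$$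
   Context: **Notation.** $\|\cdot\|_2$ is the Euclidean norm of vectors and spectral norm of matrices; $\|\cdot\|$ is the Frobenius norm of matrices (Euclidean norm for vectors). For positive sequences, $a_k=\mathcal O(b_k)$ means $a_k\le c\,b_k$ for some constant $c>0$; $a_k\asymp b_k$ means $a_k=\mathcal O(b_k)$ and $b_k=\mathcal O(a_k)$. $\mathbf 1\in\mathbb R^n$ is the all-ones vector, $\mathbf I$ the identity. **Problem.** Agents $\mathcal V=\{1,\dots,n\}$; minimize $f(x)=\frac1n\sum_{j=1}^n f_j(x)$ over $x\in\mathbb R^d$; $f^*=\min_x f(x)$. The agents communicate over a graph $\mathcal G=(\mathcal V,\mathcal E)$; $\mathcal N_i$ is the set of neighbors of $i$ (not containing $i$). $\mathbf W=[w_{ij}]$ is a nonnegative $n\times n$ weight matrix with, for $i\neq j$, $w_{ij}>0$ if $(i,j)\in\mathcal E$ and $w_{ij}=0$ otherwise. **Algorithm VRA-DGT.** Parameters $\alpha_k,\beta_k,\tilde\gamma,\gamma_k\in(0,1]$. Initial values $x_{i,1}=z^x_{i,1}\in\mathbb R^d$, $s_{i,1}=z^s_{i,1}\in\mathbb R^d$. For all $k\ge1$, $q_{i,k}=\nabla f_i(x_{i,k})$. For $k=1,2,\dots$ and all $i\in\mathcal V$: $$s_{i,k+1}=(1-\tilde\gamma)s_{i,k}+\tilde\gamma(z^s_{i,k}+w_{ii}s_{i,k})+q_{i,k},$$ $$x_{i,k+1}=(1-\gamma_k)x_{i,k}+\gamma_k(z^x_{i,k}+w_{ii}x_{i,k})-\alpha_k(s_{i,k+1}-s_{i,k}),$$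 $$z^s_{i,k+1}=(1-\beta_k)z^s_{i,k}+\beta_k\sum_{j\in\mathcal N_i}w_{ij}\left(\tfrac{s_{j,k+1}-(1-\beta_k)s_{j,k}}{\beta_k}+\zeta^s_{j,k+1}\right),$$ $$z^x_{i,k+1}=(1-\beta_k)z^x_{i,k}+\beta_k\sum_{j\in\mathcal N_i}w_{ij}\left(\tfrac{x_{j,k+1}-(1-\beta_k)x_{j,k}}{\beta_k}+\zeta^x_{j,k+1}\right),$$ where $\zeta^s_{j,k},\zeta^x_{j,k}\in\mathbb R^d$ are random information-sharing noises. **Matrix notation.** $\mathbf x_k,\mathbf s_k,\mathbf z^s_k,\mathbf z^x_k$ are the $n\times d$ matrices with rows $x_{i,k}^\top,s_{i,k}^\top,(z^s_{i,k})^\top,(z^x_{i,k})^\top$; $\mathbf y_k$ has rows $(s_{i,k+1}-s_{i,k})^\top$; $\bar x_k=\frac1n\sum_j x_{j,k}$, $\bar{\mathbf x}_k=\mathbf 1\bar x_k^\top$, $\bar{\mathbf y}_k=\frac{\mathbf 1\mathbf 1^\top}{n}\mathbf y_k$; $\tilde{\mathbf W}=\mathbf W-\mathrm{diag}(w_{11},\dots,w_{nn})$; $\mathbf e^x_k=\mathbf z^x_k-\tilde{\mathbf W}\mathbf x_k$, $\mathbf e^s_k=\mathbf z^s_k-\tilde{\mathbf W}\mathbf s_k$. **Filtrations.** $\mathcal F^x_1=\mathcal F^x_2=\{\Omega,\emptyset\}$, $\mathcal F^x_k=\sigma(\zeta^x_{j,t},\zeta^s_{j,t}: 2\le t\le k-1,\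 j\in\mathcal V)$ for $k\ge3$; $\mathcal F^s_1=\{\Omega,\emptyset\}$, and for $k\ge2$, $\mathcal F^s_k$ is generated by $\mathcal F^x_k$ together with $\zeta^s_{j,k}$, $j\in\mathcal V$. **Assumptions.** (A1) Each $f_i$ is $L$-smooth ($\|\nabla f_i(x)-\nabla f_i(y)\|\le L\|x-y\|$) and $f$ is $\mu$-strongly convex: $f(y)\ge f(x)+\langle\nabla f(x),y-x\rangle+\frac\mu2\|x-y\|^2$ ($\mu>0$). (A2) $\mathcal G$ is undirected and connected; $\mathbf W\mathbf 1=\mathbf 1$, $\mathbf 1^\top\mathbf W=\mathbf 1^\top$; $w_{ii}>0$ for some $i$. Consequently there is a constant $\eta_w\in(0,1]$, fixed throughout, with $\left\|(1-\gamma)\mathbf I+\gamma\mathbf W-\frac{\mathbf 1\mathbf 1^\top}{n}\right\|_2\le1-\gamma\eta_w$ for all $\gamma\in[0,1]$. (A3) For all $k\ge1$ and $i\ne j$: $\mathbb E[\zeta^s_{i,k}|\mathcal F^x_k]=0$, $\mathbb E[\zeta^x_{i,k}|\mathcal F^s_k]=0$, $\mathbb E[\langle\zeta^s_{i,k},\zeta^s_{j,k}\rangle|\mathcal F^x_k]=0$; and there are $\sigma_\zeta>0$, $p_1\ge2$ with $\mathbb E[\|\zeta^s_{i,k}\|_2^{p_1}|\mathcal F^x_k]\le\sigma_\zeta^{p_1}$, $\mathbb E[\|\zeta^x_{i,k}\|_2^{p_1}|\mathcal F^s_k]\le\sigma_\zeta^{p_1}$. **The constants $c_s,c_x$.** Under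 (A3) with $p_1=2$, if $\beta_k\asymp\frac1{k^{r}}$ with $r\in(1/2,1)$, or $\beta_k=\frac{a}{k+a_1}$ with $a_1\ge0$, $a\in[1,a_1+1)$, there exist constants $c_s,c_x$ with $\mathbb E[\|\mathbf e^s_k\|^2]\le c_s\beta_k$ and $\mathbb E[\|\mathbf e^x_k\|^2]\le c_x\beta_k$; these are the constants entering $\tau^D$ and $\tilde\tau^D$. *)

(* Defs.v *)
From HB Require Import structures.
From mathcomp Require Import all_boot all_order all_algebra.
From mathcomp Require Import all_classical all_reals all_analysis.

Set Implicit Arguments.
Unset Strict Implicit.
Unset Printing Implicit Defensive.

Import Order.TTheory GRing.Theory Num.Theory.
Import numFieldNormedType.Exports.

Local Open Scope classical_set_scope.
Local Open Scope ring_scope.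

(* Vectors of R^d are row vectors; the states, auxiliary variables and noises
   of the n agents at one time are the rows of an n x d matrix.  Sequences are
   indexed from k = 1: their value at 0 is never used. *)

Section Norms.
Context {R : realType}.

(* Frobenius norm, Euclidean on vectors.  The norm `|_| that the library puts
   on matrices is the sup norm, which is not the one meant here. *)
Definition fnorm {m p : nat} (A : 'M[R]_(m, p)) : R :=
  Num.sqrt (\sum_(i < m) \sum_(j < p) A i j ^+ 2).

Definition dotv {d : nat} (u v : 'rV[R]_d) : R := \sum_(l < d) u 0 l * v 0 l.

Definition specnorm {n : nat} (M : 'M[R]_n) : R :=
  sup [set fnorm (M *m v) | v in [set v : 'cV[R]_n | fnorm v <= 1]].

Definition ones (n : nat) : 'cV[R]_n := const_mx 1.

Definition avgmx (n : nat) : 'M[R]_n := n%:R^-1 *: (ones n *m (ones n)^T).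

End Norms.

Section Asymptotics.
Context {R : realType}.

(* Extended-real left-hand side, since expectations are extended real: the
   bound includes finiteness. *)
Definition isO (a : nat -> \bar R) (b : nat -> R) : Prop :=
  exists2 c : R, 0 < c & forall k, (1 <= k)%N -> (a k <= (c * b k)%:E)%E.

Definition asymp (a b : nat -> R) : Prop :=
  isO (EFin \o a) b /\ isO (EFin \o b) a.

Definition inv_pow (r : R) (k : nat) : R := 1 / k%:R `^ r.

End Asymptotics.

Section Objective.
Context {R : realType} {n d : nat}.
Implicit Types (f : 'I_n -> 'rV[R]_d -> R) (g : 'rV[R]_d -> R).

Definition grad g (x : 'rV[R]_d) : 'rV[R]_d :=
  \row_(l < d) 'D_(delta_mx 0 l) (g : 'rV[R]_d -> R^o) x.

Definition favg f (x : 'rV[R]_d) : R := n%:R^-1 * \sum_(j < n) f j x.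

(* For a strongly convex differentiable function the infimum is attained. *)
Definition fstar f : R := inf (range (favg f)).

Definition smooth (L : R) g : Prop :=
  (forall x, differentiable (g : 'rV[R]_d -> R^o) x) /\
  (forall x y, fnorm (grad g x - grad g y) <= L * fnorm (x - y)).

Definition strongly_convex (mu : R) g : Prop :=
  0 < mu /\
  forall x y, g y >= g x + dotv (grad g x) (y - x) + mu / 2 * fnorm (x - y) ^+ 2.

Definition objective_assumption f (L mu : R) : Prop :=
  (forall i, smooth L (f i)) /\ strongly_convex mu (favg f).

End Objective.

Section Network.
Context {R : realType} {n : nat}.
Implicit Types (e : rel 'I_n) (W : 'M[R]_n).

Definition network_assumption e W : Prop :=
  [/\ symmetric e /\ (forall i j, connect e i j),
      forall i j, 0 <= W i j,
      forall i j, i != j ->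
        (e i j -> 0 < W i j) /\ (~~ e i j -> W i j = 0),
      W *m ones n = ones n /\ (ones n)^T *m W = (ones n)^T
    & exists i, 0 < W i i].

Definition contraction_constant W (eta : R) : Prop :=
  0 < eta <= 1 /\
  forall gam : R, 0 <= gam <= 1 ->
    specnorm ((1 - gam)%:M + gam *: W - avgmx n) <= 1 - gam * eta.

Definition offdiag W : 'M[R]_n := W - diag_mx (\row_(i < n) W i i).

End Network.

Section Noise.
Context {R : realType} {disp : measure_display} {T : measurableType disp}.
Variable P : probability T R.

(* Y is a version of the conditional expectation of X given the
   sigma-algebra F. *)
Definition is_cond_exp (F : set (set T)) (X Y : T -> R) : Prop :=
  [/\ P.-integrable setT (EFin \o X),
      P.-integrable setT (EFin \o Y),
      forall B : set R, measurable B -> F (Y @^-1` B)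
    & forall A, F A -> (\int[P]_(w in A) (X w)%:E = \int[P]_(w in A) (Y w)%:E)%E].

Definition cond_exp_le (F : set (set T)) (X : T -> R) (c : R) : Prop :=
  exists2 Y : T -> R, is_cond_exp F X Y & {ae P, forall w, Y w <= c}.

Context {n d : nat}.
Implicit Types zeta zs zx : nat -> T -> 'M[R]_(n, d).

Definition noise_events zeta (t : nat) : set (set T) :=
  [set A | exists (j : 'I_n) (l : 'I_d),
     preimage_set_system setT (fun w => zeta t w j l) measurable A].

(* No index t qualifies when k <= 2, and then this is the trivial
   sigma-algebra. *)
Definition filt_x zs zx (k : nat) : set (set T) :=
  <<s [set A | exists2 t, (2 <= t < k)%N &
         noise_events zx t A \/ noise_events zs t A] >>.

Definition filt_s zs zx (k : nat) : set (set T) :=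
  if (k < 2)%N then [set set0; setT]
  else <<s filt_x zs zx k `|` noise_events zs k >>.

(* The moment bounds are those of order 2; zero conditional mean of a vector
   is meant coordinatewise. *)
Definition noise_assumption zs zx (sigma : R) : Prop :=
  [/\ forall k (i : 'I_n) (l : 'I_d),
        measurable_fun setT (fun w => zs k w i l) /\
        measurable_fun setT (fun w => zx k w i l),
      forall k (i : 'I_n) (l : 'I_d), (1 <= k)%N ->
        is_cond_exp (filt_x zs zx k) (fun w => zs k w i l) (cst 0) /\
        is_cond_exp (filt_s zs zx k) (fun w => zx k w i l) (cst 0),
      forall k (i j : 'I_n), (1 <= k)%N -> i != j ->
        is_cond_exp (filt_x zs zx k)
          (fun w => dotv (row i (zs k w)) (row j (zs k w))) (cst 0),
      0 < sigma
    & forall k (i : 'I_n), (1 <= k)%N ->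
        cond_exp_le (filt_x zs zx k)
          (fun w => fnorm (row i (zs k w)) ^+ 2) (sigma ^+ 2) /\
        cond_exp_le (filt_s zs zx k)
          (fun w => fnorm (row i (zx k w)) ^+ 2) (sigma ^+ 2)].

End Noise.

Section Algorithm.
Context {R : realType} {T : Type} {n d : nat}.
Variables (f : 'I_n -> 'rV[R]_d -> R) (e : rel 'I_n) (W : 'M[R]_n).
Implicit Types x s zs zx zetas zetax : nat -> T -> 'M[R]_(n, d).

Definition in_unit (a : R) : Prop := 0 < a <= 1.

(* sum over the neighbours j of i of
   w_ij ((u_{j,k+1} - (1 - b) u_{j,k}) / b + zeta_{j,k+1}) *)
Definition received (b : R) (u zeta : nat -> T -> 'M[R]_(n, d)) (k : nat)
    (w : T) (i : 'I_n) : 'rV[R]_d :=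
  \sum_(j < n | (j != i) && e i j)
    W i j *: (b^-1 *: (row j (u k.+1 w) - (1 - b) *: row j (u k w))
              + row j (zeta k.+1 w)).

(* The initial values x1 and s1 are deterministic. *)
Definition vra_dgt (alpha beta gamma : nat -> R) (tgam : R) zetas zetax
    x s zs zx : Prop :=
  (exists x1 s1 : 'M[R]_(n, d), forall w,
     [/\ x 1 w = x1, zx 1 w = x1, s 1 w = s1 & zs 1 w = s1]) /\
  forall k w i, (1 <= k)%N ->
    [/\ row i (s k.+1 w) =
          (1 - tgam) *: row i (s k w)
          + tgam *: (row i (zs k w) + W i i *: row i (s k w))
          + grad (f i) (row i (x k w)),
        row i (x k.+1 w) =
          (1 - gamma k) *: row i (x k w)
          + gamma k *: (row i (zx k w) + W i i *: row i (x k w))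
          - alpha k *: (row i (s k.+1 w) - row i (s k w)),
        row i (zs k.+1 w) =
          (1 - beta k) *: row i (zs k w)
          + beta k *: received (beta k) s zetas k w i
      & row i (zx k.+1 w) =
          (1 - beta k) *: row i (zx k w)
          + beta k *: received (beta k) x zetax k w i].

Definition avgrow (A : 'M[R]_(n, d)) : 'rV[R]_d :=
  n%:R^-1 *: \sum_(j < n) row j A.

Definition lyapunov x s (k : nat) (w : T) : R :=
  let y := s k.+1 w - s k w in
  let xbar := avgrow (x k w) in
  fnorm (y - avgmx n *m y) ^+ 2
  + fnorm (x k w - ones n *m xbar) ^+ 2
  + (favg f xbar - fstar f).

End Algorithm.

(* E ||z_k - W~ u_k||^2 <= c beta_k *)
Definition error_bound {R : realType} {disp : measure_display}
    {T : measurableType disp} (P : probability T R) {n d : nat} (W : 'M[R]_n)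
    (beta : nat -> R) (u z : nat -> T -> 'M[R]_(n, d)) (c : R) : Prop :=
  forall k, (1 <= k)%N ->
    ('E_P[fun w => (fnorm (z k w - offdiag W *m u k w) ^+ 2)%R]
       <= (c * beta k)%:E)%E.

Definition harmonic_step {R : realType} (beta : nat -> R) (a a1 : R) : Prop :=
  forall k, (1 <= k)%N -> beta k = a / (k%:R + a1).

Definition error_step {R : realType} (beta : nat -> R) : Prop :=
  (exists2 r : R, 2^-1 < r < 1 & asymp beta (inv_pow r)) \/
  (exists a a1 : R, [/\ 0 <= a1, 1 <= a < a1 + 1 & harmonic_step beta a a1]).

Section Constants.
Context {R : realType}.

Definition kappaD (L tgam eta : R) : R :=
  10 * L ^+ 2 / (tgam * eta) + 30 * L ^+ 2.

Definition deltaD (n : nat) (mu tgam eta alpha1 c1 L : R) : R :=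
  Num.min mu (Num.min (tgam * eta / alpha1 - 2 / (c1 * eta))
                      (c1 * eta - 8 * L ^+ 2 / n%:R)).

Definition tdeltaD (n : nat) (W : 'M[R]_n) (L tgam eta c1 : R) : R :=
  kappaD L tgam eta * Num.max 1 (fnorm (W - 1%:M) ^+ 2 * c1 ^+ 2).

Definition tauD (n : nat) (L tgam eta alpha1 c1 cs cx : R) : R :=
  (kappaD L tgam eta * c1 ^+ 2 + 2 * c1 / eta + 10 * c1 ^+ 2 / n%:R) * cx
  + 10 * tgam * (alpha1 * L ^+ 2 / eta + tgam / n%:R) * cs.

Definition ttauD (n : nat) (tgam eta cs sigma : R) : R :=
  4 * tgam / eta * (cs + n%:R * sigma ^+ 2).

End Constants.

(* Main.v *)
Require Import Defs.
From mathcomp Require Import all_boot all_order all_algebra.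
From mathcomp Require Import all_classical all_reals all_analysis measurable_realfun.
From mathcomp Require Import ring lra.

(** Write J for the averaging matrix, q(x) for the matrix of the local
    gradients, y_k = s_(k+1) - s_k, and e^s, e^x for the sharing errors
    z - W~ s and z - W~ x.  Eliminating z turns the algorithm into
    - x_(k+1) = ((1 - gam) I + gam W) x_k + gam e^x_k - alpha y_k,
    - y_(k+1) = ((1 - tgam) I + tgam W) y_k + tgam (e^s_(k+1) - e^s_k)
                + q(x_(k+1)) - q(x_k),
    - mean of y_k = tgam * mean of e^s_k + mean of q(x_k),

    so the averaged s-increment tracks the averaged gradient up to a sharing
    error ([vra_iteration]).  The errors obey a linear recursion driven by the
    noise alone, e_(k+1) = (1 - beta) e_k + beta W~ zeta_(k+1)
    ([sharing_error_step]).

    The Lyapunov function is estimated for each outcome separately. Mixing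
    contracts the deviations of x and y from their means by 1 - gam eta and
    1 - tgam eta ([gossip_contract]); what is added to the mixed state
    enters with weight 1 / (gam eta), resp. 1 / (tgam eta) ([sqn_jensen]).
    The mean of x moves by - alpha u, where u is the averaged gradient plus
    averaged errors. In the descent lemma, with G the gradient of f at the
    mean, the identity 2 <G, u> = |G|^2 + |u|^2 - |G - u|^2 yields the
    contraction factor 1 - alpha mu through the Polyak-Lojasiewicz
    inequality and leaves a negative multiple of |u|^2. That multiple
    absorbs the two places where the displacement of the mean costs
    something: the second-order term of the descent lemma and the Lipschitz
    bound on q(x_(k+1)) - q(x_k). The displacement is therefore split
    orthogonally into its mean and its deviation ([step_dx]). The sum of the
    estimates is [step_all]; for small alpha it reads ([contraction_step])

    V_(k+1) <= (1 - delta alpha + tdelta alpha^2) V_k + alpha * (errors)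
               + beta^2 * (errors + noise).

    Expectations can then be taken term by term, and the values E V_k obey
    the recursion with the constants tau and ttau ([merit_step]).  The rates
    follow from the scalar recursion: by Chung's argument ([chung]) for
    decreasing steps, by an explicit induction for a constant step
    ([rate_constant]).  For the finitely many decreasing steps that are not
    yet small, a crude one-step bound shows that the expectation stays finite
    ([crude_step]).

    The conditional means enter in the existence of the constants cs, cx:
    they make the error e_k orthogonal to the next noise ([centered_mul],
    [error_orth]), so that
    E |e_(k+1)|^2 <= (1 - beta)^2 E |e_k|^2 + beta^2 n sigma^2, and Chung's
    argument applies again ([error_bound_exists]). *)

Set Implicit Arguments.
Unset Strict Implicit.
Unset Printing Implicit Defensive.
Import Order.TTheory GRing.Theory Num.Theory.
Import numFieldNormedType.Exports.
Local Open Scope classical_set_scope.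
Local Open Scope ring_scope.

(** * Frobenius inner product and spectral norm *)

Section Frobenius.
Context {R : realType}.

Definition frob {m p : nat} (A B : 'M[R]_(m, p)) : R :=
  \sum_i \sum_j A i j * B i j.

(** The square of [fnorm]: with it every estimate is polynomial. *)
Definition sqn {m p : nat} (A : 'M[R]_(m, p)) : R := frob A A.

Lemma sqnE m p (A : 'M[R]_(m, p)) : sqn A = \sum_i \sum_j A i j ^+ 2.
Proof. by apply: eq_bigr => i _; apply: eq_bigr => j _; rewrite expr2. Qed.

Lemma sqn_ge0 m p (A : 'M[R]_(m, p)) : 0 <= sqn A.
Proof. by rewrite sqnE; do 2!apply: sumr_ge0 => ? _; exact: sqr_ge0. Qed.

Lemma fnorm_sq m p (A : 'M[R]_(m, p)) : fnorm A ^+ 2 = sqn A.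
Proof. by rewrite /fnorm -sqnE sqr_sqrtr ?sqn_ge0. Qed.

Lemma fnorm_ge0 m p (A : 'M[R]_(m, p)) : 0 <= fnorm A.
Proof. exact: sqrtr_ge0. Qed.

Lemma dotvE p (u v : 'rV[R]_p) : dotv u v = frob u v.
Proof. by rewrite /frob big_ord1. Qed.

Lemma frobC m p (A B : 'M[R]_(m, p)) : frob A B = frob B A.
Proof. by apply: eq_bigr => i _; apply: eq_bigr => j _; rewrite mulrC. Qed.

Lemma frobDl m p (A B C : 'M[R]_(m, p)) : frob (A + B) C = frob A C + frob B C.
Proof.
rewrite /frob -big_split; apply: eq_bigr => i _.
by rewrite -big_split; apply: eq_bigr => j _; rewrite mxE mulrDl.
Qed.

Lemma frobZl m p a (A B : 'M[R]_(m, p)) : frob (a *: A) B = a * frob A B.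
Proof.
rewrite /frob big_distrr; apply: eq_bigr => i _.
by rewrite big_distrr; apply: eq_bigr => j _; rewrite mxE /= mulrA.
Qed.

Lemma frobNl m p (A B : 'M[R]_(m, p)) : frob (- A) B = - frob A B.
Proof. by rewrite -scaleN1r frobZl mulN1r. Qed.

Lemma frobDr m p (A B C : 'M[R]_(m, p)) : frob C (A + B) = frob C A + frob C B.
Proof. by rewrite frobC frobDl !(frobC _ C). Qed.

Lemma frobZr m p a (A B : 'M[R]_(m, p)) : frob B (a *: A) = a * frob B A.
Proof. by rewrite frobC frobZl frobC. Qed.

Lemma frobNr m p (A B : 'M[R]_(m, p)) : frob B (- A) = - frob B A.
Proof. by rewrite frobC frobNl frobC. Qed.

Definition frob_lin := (@frobDl, @frobDr, @frobNl, @frobNr, @frobZl, @frobZr).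

Lemma sqnZ m p a (A : 'M[R]_(m, p)) : sqn (a *: A) = a ^+ 2 * sqn A.
Proof. by rewrite /sqn !frob_lin; ring. Qed.

Lemma sqnN m p (A : 'M[R]_(m, p)) : sqn (- A) = sqn A.
Proof. by rewrite /sqn !frob_lin; ring. Qed.

Lemma sqnD m p (A B : 'M[R]_(m, p)) :
  sqn (A + B) = sqn A + 2 * frob A B + sqn B.
Proof. by rewrite /sqn !frob_lin (frobC B A); ring. Qed.

Lemma sqnBC m p (A B : 'M[R]_(m, p)) : sqn (A - B) = sqn (B - A).
Proof. by rewrite -sqnN opprB. Qed.

Lemma sqn_eq0 m p (A : 'M[R]_(m, p)) : sqn A = 0 -> A = 0.
Proof.
rewrite sqnE => /eqP; rewrite psumr_eq0 => [/allP A0|i _]; last first.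
  by apply: sumr_ge0 => j _; exact: sqr_ge0.
apply/matrixP => i j; have := A0 i (mem_index_enum i).
rewrite psumr_eq0 => [/allP/(_ j (mem_index_enum j))|? _]; last exact: sqr_ge0.
by rewrite sqrf_eq0 mxE => /eqP.
Qed.

(** Young's inequality, from expanding the squared norm of r A - B. *)
Lemma frob_le m p (A B : 'M[R]_(m, p)) (r : R) : 0 < r ->
  2 * frob A B <= r * sqn A + r^-1 * sqn B.
Proof.
move=> r0; have := sqn_ge0 (r *: A - B).
rewrite sqnD sqnN frobNr frobZl sqnZ => h.
have -> : r * sqn A + r^-1 * sqn B = r^-1 * (r ^+ 2 * sqn A + sqn B).
  by field; rewrite gt_eqF.
by rewrite ler_pdivlMl //; lra.
Qed.

Lemma frob_CS m p (A B : 'M[R]_(m, p)) : frob A B ^+ 2 <= sqn A * sqn B.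
Proof.
have := sqn_ge0 (sqn B *: A - frob A B *: B).
have [/sqn_eq0 ->|B0] := eqVneq (sqn B) 0.
  by rewrite -(scale0r B) sqnZ frobZr; lra.
have {B0}Bp : 0 < sqn B by rewrite lt_def B0 sqn_ge0.
rewrite sqnD sqnN !sqnZ frobNr frobZl frobZr => h.
have : 0 <= sqn B * (sqn A * sqn B - frob A B ^+ 2) by lra.
by rewrite pmulr_rge0 // subr_ge0.
Qed.

Lemma frob_fnorm m p (A B : 'M[R]_(m, p)) : frob A B <= fnorm A * fnorm B.
Proof.
apply: (le_trans (ler_norm _)).
rewrite -(@ler_sqr R) ?nnegrE ?mulr_ge0 ?fnorm_ge0 ?normr_ge0 //.
by rewrite exprMn !fnorm_sq -normrX ger0_norm ?sqr_ge0 ?frob_CS.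
Qed.

Lemma sqn_le2 m p (A B : 'M[R]_(m, p)) : sqn (A + B) <= 2 * (sqn A + sqn B).
Proof. by rewrite sqnD; have := frob_le A B ltr01; rewrite invr1; lra. Qed.

Lemma sqn_le3 m p (A B C : 'M[R]_(m, p)) :
  sqn (A + B + C) <= 3 * (sqn A + sqn B + sqn C).
Proof.
rewrite !sqnD frobDl; have := (frob_le A B ltr01, frob_le A C ltr01).
by have := frob_le B C ltr01; rewrite invr1 => ? [? ?]; lra.
Qed.

(** Convexity of the squared norm with weights 1 - t and t, applied to
    A / (1 - t) and B / t.  The weight of B is exactly 1 / t, which is what
    the constants 2 / (c1 eta) and 2 c1 / eta of the theorem require.  At
    t = 1 the hypothesis forces A = 0. *)
Lemma sqn_jensen m p (A B : 'M[R]_(m, p)) (M t : R) : 0 < t <= 1 -> 0 <= M ->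
  sqn A <= (1 - t) ^+ 2 * M -> sqn (A + B) <= (1 - t) * M + t^-1 * sqn B.
Proof.
move=> /andP[t0 t1] M0 AM.
have [t1'|t1'] := eqVneq t 1.
  have A0 : sqn A = 0.
    by apply/eqP; rewrite eq_le sqn_ge0 andbT; move: AM; rewrite t1'; lra.
  by rewrite (sqn_eq0 A0) add0r t1' invr1; lra.
have t'0 : 0 < 1 - t by rewrite subr_gt0 lt_def eq_sym t1' t1.
have r0 : 0 < t / (1 - t) by rewrite divr_gt0.
rewrite sqnD; have h := frob_le A B r0.
have e1 : sqn A + t / (1 - t) * sqn A = (1 - t)^-1 * sqn A.
  by field; rewrite gt_eqF.
have e2 : (t / (1 - t))^-1 * sqn B + sqn B = t^-1 * sqn B.
  by field; rewrite !gt_eqF.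
have : (1 - t)^-1 * sqn A <= (1 - t) * M.
  by rewrite ler_pdivrMl // mulrA -expr2.
by lra.
Qed.

Lemma frob_tr m p (A B : 'M[R]_(m, p)) : frob A B = \tr (A^T *m B).
Proof.
rewrite /frob exchange_big; apply: eq_bigr => j _.
by rewrite mxE; apply: eq_bigr => i _; rewrite mxE.
Qed.

Lemma frob_mulmx m n p (M : 'M[R]_(m, n)) (A : 'M[R]_(n, p)) (B : 'M[R]_(m, p)) :
  frob (M *m A) B = frob A (M^T *m B).
Proof. by rewrite !frob_tr trmx_mul mulmxA. Qed.

Lemma sqn_row m p (A : 'M[R]_(m, p)) : sqn A = \sum_i sqn (row i A).
Proof.
by apply: eq_bigr => i _; rewrite /sqn /frob big_ord1; apply: eq_bigr => j _; rewrite mxE.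
Qed.

Lemma sqn_tr m p (A : 'M[R]_(m, p)) : sqn A^T = sqn A.
Proof.
by rewrite /sqn /frob exchange_big; do 2![apply: eq_bigr => ? _]; rewrite mxE.
Qed.

Lemma sqn_col m p (A : 'M[R]_(m, p)) : sqn A = \sum_j sqn (col j A).
Proof.
by rewrite -sqn_tr sqn_row; apply: eq_bigr => j _; rewrite -tr_col sqn_tr.
Qed.

Lemma sqn_mulmx m n p (M : 'M[R]_(m, n)) (A : 'M[R]_(n, p)) :
  sqn (M *m A) <= sqn M * sqn A.
Proof.
rewrite (sqn_row M) (sqn_col A) big_distrl [leLHS]sqnE; apply: ler_sum => i _.
rewrite big_distrr; apply: ler_sum => j _.
have -> : (M *m A) i j = frob (row i M) (col j A)^T.
  by rewrite mxE /frob big_ord1; apply: eq_bigr => k _; rewrite !mxE.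
by rewrite -(sqn_tr (col j A)); exact: frob_CS.
Qed.

(** By Cauchy-Schwarz the set whose supremum defines [specnorm M] is bounded by
    [fnorm M], so the supremum is a genuine bound on the unit ball; scaling
    extends it to all vectors. *)
Lemma specnorm_ub n (M : 'M[R]_n) (v : 'cV[R]_n) :
  fnorm (M *m v) <= specnorm M * fnorm v.
Proof.
have fZ (a : R) (u : 'cV[R]_n) : 0 <= a -> fnorm (a *: u) = a * fnorm u.
  move=> a0; apply/eqP; rewrite -(@eqrXn2 _ 2) ?mulr_ge0 ?fnorm_ge0 //.
  by rewrite exprMn !fnorm_sq sqnZ.
have [v0|v0] := eqVneq (fnorm v) 0.
  have /sqn_eq0 -> : sqn v = 0 by rewrite -fnorm_sq v0 expr0n.
  by rewrite mulmx0 -(scale0r (0 : 'cV[R]_n)) !fZ // !mul0r mulr0.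
have vp : 0 < fnorm v by rewrite lt_def v0 fnorm_ge0.
have -> : v = fnorm v *: ((fnorm v)^-1 *: v) by rewrite scalerA divff // scale1r.
rewrite -scalemxAr fZ ?fnorm_ge0 // mulrC [X in _ <= _ * X]fZ ?fnorm_ge0 //.
rewrite fZ ?invr_ge0 ?fnorm_ge0 // mulVf // mulr1 ler_wpM2r ?fnorm_ge0 //.
apply: sup_upper_bound; last first.
  exists ((fnorm v)^-1 *: v) => //=.
  by rewrite fZ ?invr_ge0 ?fnorm_ge0 // mulVf.
split.
  exists (fnorm (M *m (0 : 'cV[R]_n))); exists 0 => //=.
  by rewrite -(scale0r 0) fZ // mul0r.
exists (fnorm M) => _ [u /= u1 <-].
rewrite -(@ler_sqr R) ?nnegrE ?fnorm_ge0 // !fnorm_sq.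
apply: (le_trans (sqn_mulmx _ _)); rewrite ler_piMr ?sqn_ge0 //.
by rewrite -fnorm_sq expr_le1 // fnorm_ge0.
Qed.

(** A square matrix acts on the columns of A separately, so its spectral norm
    also bounds its effect on the Frobenius norm. *)
Lemma sqn_specnorm n p (M : 'M[R]_n) (A : 'M[R]_(n, p)) (c : R) :
  specnorm M <= c -> sqn (M *m A) <= c ^+ 2 * sqn A.
Proof.
move=> Mc; rewrite !sqn_col big_distrr; apply: ler_sum => j _ /=.
rewrite colE -mulmxA -colE -![sqn (col _ _)]fnorm_sq -fnorm_sq -exprMn.
have h : fnorm (M *m col j A) <= c * fnorm (col j A).
  by rewrite (le_trans (specnorm_ub _ _)) // ler_wpM2r ?fnorm_ge0.
by rewrite ler_sqr ?nnegrE ?fnorm_ge0 // (le_trans (fnorm_ge0 _) h).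
Qed.

End Frobenius.

(** * Averaging and doubly stochastic mixing *)

Section Averaging.
Context {R : realType} {n : nat}.
Local Notation J := (@avgmx R n).

Lemma avgmxE d (A : 'M[R]_(n, d)) : J *m A = ones n *m avgrow A.
Proof.
rewrite /avgmx /avgrow -scalemxAl -scalemxAr -mulmxA; congr (_ *: (_ *m _)).
apply/rowP => l; rewrite !mxE summxE; apply: eq_bigr => j _.
by rewrite !mxE mul1r.
Qed.

Lemma sqn_ones d (v : 'rV[R]_d) : sqn (ones n *m v) = n%:R * sqn v.
Proof.
rewrite sqn_row (eq_bigr (fun=> sqn v)) => [|i _].
  by rewrite sumr_const card_ord mulr_natl.
by congr sqn; apply/rowP => l; rewrite !mxE big_ord1 mxE mul1r.
Qed.

Hypothesis n0 : (0 < n)%N.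

Let n_neq0 : n%:R != 0 :> R. Proof. by rewrite pnatr_eq0 -lt0n. Qed.

Lemma avgmx_tr : J^T = J.
Proof. by rewrite /avgmx linearZ /= trmx_mul trmxK. Qed.

Lemma avgrow_ones d (v : 'rV[R]_d) : avgrow (ones n *m v) = v.
Proof.
rewrite /avgrow (eq_bigr (fun=> v)) => [|j _].
  by rewrite sumr_const card_ord -[v *+ n]scaler_nat scalerA mulVf // scale1r.
by apply/rowP => l; rewrite !mxE big_ord1 mxE mul1r.
Qed.

Lemma avgmx_idem d (A : 'M[R]_(n, d)) : J *m (J *m A) = J *m A.
Proof. by rewrite !avgmxE avgrow_ones. Qed.

(** Pythagoras: averaging is an orthogonal projection. *)
Lemma sqn_split d (A : 'M[R]_(n, d)) : sqn A = sqn (J *m A) + sqn (A - J *m A).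
Proof.
rewrite -{1}[A](subrK (J *m A)) (sqnD (A - J *m A)) (frobC (A - _)) frob_mulmx avgmx_tr.
by rewrite mulmxBr avgmx_idem subrr -(scale0r (0 : 'M[R]_(n, d))) frobZr; ring.
Qed.

Lemma sqn_sub_avg_le d (A : 'M[R]_(n, d)) : sqn (A - J *m A) <= sqn A.
Proof. by rewrite (sqn_split A) lerDr sqn_ge0. Qed.

Lemma sqn_avgmx d (A : 'M[R]_(n, d)) : sqn (J *m A) = n%:R * sqn (avgrow A).
Proof. by rewrite avgmxE sqn_ones. Qed.

Lemma sqn_avgrow d (A : 'M[R]_(n, d)) : sqn (avgrow A) <= n%:R^-1 * sqn A.
Proof.
rewrite ler_pdivlMl ?ltr0n // -sqn_avgmx (sqn_split A) lerDl; exact: sqn_ge0.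
Qed.

Lemma avgrowD d (A B : 'M[R]_(n, d)) : avgrow (A + B) = avgrow A + avgrow B.
Proof.
by rewrite /avgrow -scalerDr -big_split; congr (_ *: _); apply: eq_bigr => i _; rewrite linearD.
Qed.

Lemma avgrowZ d a (A : 'M[R]_(n, d)) : avgrow (a *: A) = a *: avgrow A.
Proof.
rewrite /avgrow scalerA mulrC -scalerA [in RHS]scaler_sumr; congr (_ *: _).
by apply: eq_bigr => i _; rewrite linearZ.
Qed.

Lemma avgrowN d (A : 'M[R]_(n, d)) : avgrow (- A) = - avgrow A.
Proof. by rewrite -scaleN1r avgrowZ scaleN1r. Qed.

End Averaging.

Section Gossip.
Context {R : realType} {n : nat}.
Variable W : 'M[R]_n.
Hypothesis n0 : (0 < n)%N.
Hypothesis Wrow : W *m ones n = ones n.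
Hypothesis Wcol : (ones n)^T *m W = (ones n)^T.
Local Notation J := (@avgmx R n).

Lemma gossip_avg d (A : 'M[R]_(n, d)) : W *m (J *m A) = J *m A.
Proof. by rewrite avgmxE mulmxA Wrow. Qed.

Lemma avg_gossip d (A : 'M[R]_(n, d)) : J *m (W *m A) = J *m A.
Proof. by rewrite mulmxA /avgmx -scalemxAl -mulmxA Wcol. Qed.

Lemma avgrow_gossip d (A : 'M[R]_(n, d)) : avgrow (W *m A) = avgrow A.
Proof.
by rewrite -[LHS](avgrow_ones n0) -avgmxE avg_gossip avgmxE avgrow_ones.
Qed.

(** W fixes the constant vectors on both sides, so the deviation of the mixed
    state is the image of the deviation of A under
    (1 - gam) I + gam W - J, whose spectral norm is controlled. *)
Lemma gossip_contract d (A G : 'M[R]_(n, d)) eta gam :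
  contraction_constant W eta -> 0 <= gam <= 1 ->
  G = (1 - gam) *: A + gam *: (W *m A) ->
  sqn (G - J *m G) <= (1 - gam * eta) ^+ 2 * sqn (A - J *m A).
Proof.
move=> [_ Weta] gam01 GE.
suff -> : G - J *m G = ((1 - gam)%:M + gam *: W - J) *m (A - J *m A).
  by apply: sqn_specnorm; apply: Weta.
move: GE (avg_gossip A) (gossip_avg A) (avgmx_idem n0 A).
generalize (@avgmx R n) => K -> KW WK KK.
rewrite mulmxBl mulmxDl !mulmxBr !mulmxDr !mul_scalar_mx -!scalemxAl -!scalemxAr.
rewrite KW WK KK; move: (W *m A) (K *m A) => B C.
by apply/matrixP => i l; rewrite !mxE; ring.
Qed.

Hypothesis W_ge0 : forall i j, 0 <= W i j.

(** Jensen's inequality for weights of total mass at most one: the weighted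
    variance around the weighted sum is nonnegative. *)
Lemma weighted_sq (c z : 'I_n -> R) : (forall j, 0 <= c j) -> \sum_j c j <= 1 ->
  (\sum_j c j * z j) ^+ 2 <= \sum_j c j * z j ^+ 2.
Proof.
move=> c0 c1.
have e r : \sum_j c j * (z j - r) ^+ 2 =
    \sum_j c j * z j ^+ 2 - 2 * r * (\sum_j c j * z j) + r ^+ 2 * \sum_j c j.
  rewrite !mulr_sumr -sumrN -!big_split /=.
  by apply: eq_bigr => j _; ring.
have := e (\sum_j c j * z j); set m := \sum_j c j * z j => {}e.
have h : 0 <= \sum_j c j * (z j - m) ^+ 2.
  by apply: sumr_ge0 => j _; rewrite mulr_ge0 ?sqr_ge0.
have : m ^+ 2 * \sum_j c j <= m ^+ 2 by rewrite ler_piMr ?sqr_ge0.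
by lra.
Qed.

Lemma offdiagE i j : offdiag W i j = if i == j then 0 else W i j.
Proof. by rewrite !mxE; case: eqP => [->|_]; rewrite ?mulr1n ?mulr0n ?subrr ?subr0. Qed.

Lemma offdiag_ge0 i j : 0 <= offdiag W i j.
Proof. by rewrite offdiagE; case: ifP. Qed.

Lemma offdiag_le i j : offdiag W i j <= W i j.
Proof. by rewrite offdiagE; case: ifP. Qed.

(** Jensen's inequality in each row, whose weights sum to at most one; then the
    column sums, at most one as well, bound the total weight of each entry. *)
Lemma sqn_offdiag d (A : 'M[R]_(n, d)) : sqn (offdiag W *m A) <= sqn A.
Proof.
have rowW i : \sum_j W i j = 1.
  have /matrixP/(_ i 0) := Wrow; rewrite !mxE => <-.
  by apply: eq_bigr => j _; rewrite mxE mulr1.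
have colW j : \sum_i W i j = 1.
  have /matrixP/(_ 0 j) := Wcol; rewrite !mxE => <-.
  by apply: eq_bigr => i _; rewrite !mxE mul1r.
apply: (@le_trans _ _ (\sum_i \sum_l \sum_j offdiag W i j * A j l ^+ 2)).
  rewrite sqnE; apply: ler_sum => i _; apply: ler_sum => l _; rewrite mxE.
  apply: weighted_sq => [j|]; first exact: offdiag_ge0.
  by rewrite -(rowW i); apply: ler_sum => j _; exact: offdiag_le.
rewrite sqnE exchange_big [leRHS]exchange_big; apply: ler_sum => l _ /=.
rewrite exchange_big; apply: ler_sum => j _ /=.
rewrite -mulr_suml ler_piMl ?sqr_ge0 // -(colW j).
by apply: ler_sum => i _; exact: offdiag_le.
Qed.

End Gossip.

(** * Smooth and strongly convex objectives *)

Section Smooth.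
Context {R : realType} {d : nat}.
Implicit Types (g : 'rV[R]_d -> R) (x y v : 'rV[R]_d).

Lemma derive_grad g x v : differentiable (g : 'rV[R]_d -> R^o) x ->
  'D_v (g : 'rV[R]_d -> R^o) x = frob (grad g x) v.
Proof.
move=> dg; rewrite deriveE // {1}[v]row_sum_delta linear_sum -dotvE.
by apply: eq_bigr => l _; rewrite linearZ mxE deriveE // mulrC.
Qed.

Lemma smooth_norm L g : smooth L g -> smooth `|L| g.
Proof.
move=> [dg Lg]; split=> // x y; apply: (le_trans (Lg x y)).
by rewrite ler_wpM2r ?fnorm_ge0 ?ler_norm.
Qed.

Lemma smooth_sq L g x y : 0 <= L -> smooth L g ->
  sqn (grad g x - grad g y) <= L ^+ 2 * sqn (x - y).
Proof.
move=> L0 [_ Lg]; rewrite -!fnorm_sq -exprMn ler_sqr ?nnegrE ?fnorm_ge0 //.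
by rewrite mulr_ge0 ?fnorm_ge0.
Qed.

(** The function psi below, t |-> g (x + t v) - t <grad g x, v> - L t^2 |v|^2 / 2,
    has a nonpositive derivative on the unit interval because the gradient is
    L-Lipschitz; the mean value theorem compares its end values. *)
Lemma descent L g x v : 0 <= L -> smooth L g ->
  g (x + v) <= g x + frob (grad g x) v + L / 2 * sqn v.
Proof.
move=> L0 Lg; have [dg gL] := Lg.
pose phi (t : R) : R := g (t *: v + x).
have dphi (t : R) : is_derive t 1 phi (frob (grad g (t *: v + x)) v).
  have phiE h : phi (h *: 1 + t) = g (h *: v + (t *: v + x)).
    by rewrite /phi scalerDl -scalerA scale1r addrA.
  have h : derivable (g : 'rV[R]_d -> R^o) (t *: v + x) v.
    exact: diff_derivable.
  apply: DeriveDef.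
    by move: h; rewrite /derivable; under eq_fun do rewrite /= -phiE.
  rewrite -derive_grad // /derive.
  by under eq_fun do rewrite /= phiE.
pose a := frob (grad g x) v; pose b := sqn v.
pose psi (t : R) : R := phi t - t * a - L / 2 * b * t ^+ 2.
pose dpsi (t : R) : R := frob (grad g (t *: v + x)) v - a - L * b * t.
have ipsi (t : R) : is_derive t 1 psi (dpsi t).
  have := dphi t => ?; apply: is_derive_eq.
  by rewrite /dpsi /GRing.scale /=; field.
have [|c /[!in_itv]/= /andP[c0 c1]] := MVT (@ltr01 R) (fun t _ => ipsi t).
  apply: derivable_within_continuous => t _.
  by apply: ex_derive.
rewrite subr0 mulr1 => psic.
have fr : frob (grad g (c *: v + x) - grad g x) v <= L * c * b.
  apply: (le_trans (frob_fnorm _ _)); apply: (@le_trans _ _ (L * fnorm (c *: v) * fnorm v)).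
    rewrite ler_wpM2r ?fnorm_ge0 //; apply: (le_trans (gL _ _)); by rewrite addrK.
  have -> : fnorm (c *: v) = c * fnorm v.
    apply/eqP; rewrite -(@eqrXn2 _ 2) ?mulr_ge0 ?fnorm_ge0 ?ltW //.
    by rewrite exprMn !fnorm_sq sqnZ.
  by rewrite /b -fnorm_sq expr2 !mulrA.
have : dpsi c <= 0.
  by rewrite /dpsi; move: fr; rewrite !frob_lin -/a (mulrAC L); lra.
have p0 : psi 0 = g x by rewrite /psi /phi scale0r add0r; ring.
have p1 : psi 1 = g (x + v) - a - L / 2 * b.
  by rewrite /psi /phi scale1r (addrC v); ring.
by rewrite -psic p0 p1 -/a -/b; lra.
Qed.

End Smooth.

Section AverageObjective.
Context {R : realType} {n d : nat}.
Variables (f : 'I_n -> 'rV[R]_d -> R) (L mu : R).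
Hypothesis n0 : (0 < n)%N.
Hypothesis L0 : 0 <= L.
Hypothesis fL : forall i, smooth L (f i).
Local Notation J := (@avgmx R n).

Definition gradmx (x : 'M[R]_(n, d)) : 'M[R]_(n, d) :=
  \matrix_(i, l) grad (f i) (row i x) 0 l.

Lemma row_gradmx x i : row i (gradmx x) = grad (f i) (row i x).
Proof. by apply/rowP => l; rewrite !mxE. Qed.

Lemma favgE : favg f = n%:R^-1 *: (\sum_i (f i : 'rV[R]_d -> R^o)).
Proof. by apply/funext => x; rewrite /favg /= fct_sumE. Qed.

Lemma grad_favg x : grad (favg f) x = avgrow (gradmx (ones n *m x)).
Proof.
have dfi i v : derivable (f i : 'rV[R]_d -> R^o) x v.
  by apply: diff_derivable; have [] := fL i.
apply/rowP => l; rewrite mxE favgE deriveZ; last exact: derivable_sum.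
rewrite derive_sum // /avgrow mxE summxE.
have rowx i : row i (ones n *m x) = x.
  by apply/rowP => k; rewrite !mxE big_ord1 mxE mul1r.
by under [in RHS]eq_bigr do rewrite row_gradmx rowx mxE.
Qed.

Lemma gradmx_lip x y : sqn (gradmx x - gradmx y) <= L ^+ 2 * sqn (x - y).
Proof.
rewrite (sqn_row (gradmx x - _)) (sqn_row (x - y)) big_distrr /=.
apply: ler_sum => i _; rewrite !linearB /= !row_gradmx.
exact: smooth_sq.
Qed.

Lemma smooth_favg : smooth L (favg f).
Proof.
split=> [x|x y].
  rewrite favgE; apply: differentiableZ; apply: differentiable_sum => i.
  by have [] := fL i.
rewrite -(@ler_sqr R) ?nnegrE ?mulr_ge0 ?fnorm_ge0 // exprMn !fnorm_sq.
rewrite !grad_favg -avgrowN -avgrowD.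
apply: (le_trans (sqn_avgrow n0 _)); rewrite ler_pdivrMl ?ltr0n //.
by rewrite (le_trans (gradmx_lip _ _)) // -mulmxBr sqn_ones mulrCA.
Qed.

(** The gradient at the mean is the mean of the local gradients at the mean,
    and each of these moves by at most L times the deviation of its agent. *)
Lemma grad_consensus (x : 'M[R]_(n, d)) :
  sqn (grad (favg f) (avgrow x) - avgrow (gradmx x)) <=
  L ^+ 2 / n%:R * sqn (x - J *m x).
Proof.
rewrite grad_favg -avgmxE -avgrowN -avgrowD.
apply: (le_trans (sqn_avgrow n0 _)); rewrite ler_pdivrMl ?ltr0n //.
have -> : n%:R * (L ^+ 2 / n%:R * sqn (x - J *m x)) = L ^+ 2 * sqn (x - J *m x).
  by field; rewrite pnatr_eq0 -lt0n.
by rewrite (sqnBC x); exact: gradmx_lip.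
Qed.

Hypothesis fmu : strongly_convex mu (favg f).

(** The minimum over y of the quadratic lower bound that strong convexity
    provides at x. *)
Lemma favg_ge x y : favg f x - (2 * mu)^-1 * sqn (grad (favg f) x) <= favg f y.
Proof.
have [mu0 /(_ x y)] := fmu; rewrite fnorm_sq dotvE sqnBC.
have := frob_le (- grad (favg f) x) (y - x) (_ : 0 < mu^-1).
rewrite invr_gt0 invrK sqnN frobNl => /(_ mu0).
by rewrite invfM; lra.
Qed.

Let favg_has_inf : has_inf (range (favg f)).
Proof.
split; first by exists (favg f 0); exists 0.
by eexists => _ [y _ <-]; exact: (favg_ge 0).
Qed.

Lemma fstar_le x : fstar f <= favg f x.
Proof. by apply: ge_inf; [case: favg_has_inf|exists x]. Qed.

Lemma polyak_lojasiewicz x :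
  2 * mu * (favg f x - fstar f) <= sqn (grad (favg f) x).
Proof.
have [mu0 _] := fmu.
rewrite -ler_pdivlMl ?mulr_gt0 // lerBlDr addrC -lerBlDr.
apply: lb_le_inf; first by case: favg_has_inf.
by move=> _ [y _ <-]; exact: favg_ge.
Qed.

(** A gradient step of length 1 / (L + 1) decreases the objective by at least
    |grad|^2 / (2 (L + 1)) and cannot pass below the infimum. *)
Lemma grad_favg_le x :
  sqn (grad (favg f) x) <= 2 * (L + 1) * (favg f x - fstar f).
Proof.
pose s := (L + 1)^-1; set g := grad _ _.
have L1 : 0 < L + 1 by rewrite ltr_wpDl.
have := descent x (- s *: g) L0 smooth_favg.
rewrite frobZr sqnZ -/g -/(sqn g) => h1.
have h2 := fstar_le (x - s *: g).
rewrite -ler_pdivrMl ?mulr_gt0 //; rewrite scaleNr in h1.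
have h3 : 0 <= (L + 1)^-1 ^+ 2 * sqn g by rewrite mulr_ge0 ?sqr_ge0 ?sqn_ge0.
have -> : (2 * (L + 1))^-1 * sqn g = s * sqn g - (L + 1) / 2 * (s ^+ 2 * sqn g).
  by rewrite /s; field; rewrite gt_eqF.
by rewrite -/s in h3; lra.
Qed.

End AverageObjective.

(** * One iteration, outcome by outcome *)

Section OneStep.
Context {R : realType} {n d : nat}.
Variables (f : 'I_n -> 'rV[R]_d -> R) (L mu : R) (W : 'M[R]_n) (eta : R).
Hypothesis n0 : (0 < n)%N.
Hypothesis L0 : 0 <= L.
Hypothesis fL : forall i, smooth L (f i).
Hypothesis fmu : strongly_convex mu (favg f).
Hypothesis Wrow : W *m ones n = ones n.
Hypothesis Wcol : (ones n)^T *m W = (ones n)^T.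
Hypothesis W_ge0 : forall i j, 0 <= W i j.
Hypothesis Weta : contraction_constant W eta.
Local Notation J := (@avgmx R n).

Definition deviation (A : 'M[R]_(n, d)) := A - J *m A.

Lemma deviationD A B : deviation (A + B) = deviation A + deviation B.
Proof. by rewrite /deviation mulmxDr opprD addrACA. Qed.

Lemma deviationZ c A : deviation (c *: A) = c *: deviation A.
Proof. by rewrite /deviation -scalemxAr scalerBr. Qed.

Lemma sqn_deviation_le A : sqn (deviation A) <= sqn A.
Proof. exact: sqn_sub_avg_le. Qed.

Variables (x y ex es x' y' zeta : 'M[R]_(n, d)) (a b g tg c1 : R).
Hypothesis tg01 : 0 < tg <= 1.
Hypothesis g01 : 0 < g <= 1.
Hypothesis a0 : 0 < a.
Hypothesis c10 : 0 < c1.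
Hypothesis gE : g = c1 * a.
Hypothesis x'E : x' = (1 - g) *: x + g *: (W *m x) + g *: ex - a *: y.
Hypothesis y'E : y' = (1 - tg) *: y + tg *: (W *m y)
  + tg *: (b *: (offdiag W *m zeta - es)) + (gradmx f x' - gradmx f x).
Hypothesis ybar : avgrow y = tg *: avgrow es + avgrow (gradmx f x).

(* minus the displacement of the mean of x, divided by the step a: see xbarE *)
Let u := avgrow y - c1 *: avgrow ex.

Let eta01 : 0 < eta <= 1. Proof. by have [] := Weta. Qed.
Let eta0 : 0 < eta. Proof. by case/andP: eta01. Qed.
Let mulr01 (p q : R) : 0 < p <= 1 -> 0 < q <= 1 -> 0 < p * q <= 1.
Proof.
by move=> /andP[p0 p1] /andP[q0 q1]; rewrite mulr_gt0 // mulr_ile1 // ltW.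
Qed.

(** Mixing contracts; the new terms are the change of the sharing error, which
    is b times an error plus noise, and the change of the gradients. *)
Lemma step_y : sqn (deviation y') <= (1 - tg * eta) * sqn (deviation y)
  + 4 * tg / eta * b ^+ 2 * (sqn es + sqn zeta)
  + 2 * L ^+ 2 / (tg * eta) * sqn (x' - x).
Proof.
have /andP[tg0 tg1] := tg01; have tgc : 0 <= tg <= 1 by rewrite ltW.
set E := tg *: (b *: (offdiag W *m zeta - es)).
set D := gradmx f x' - gradmx f x.
set G := (1 - tg) *: y + tg *: (W *m y).
have cG : sqn (deviation G) <= (1 - tg * eta) ^+ 2 * sqn (deviation y).
  exact: (gossip_contract n0 Wrow Wcol Weta tgc erefl).
have t01 := mulr01 tg01 eta01; have /andP[t0 t1] := t01.
rewrite y'E -/E -/D -/G -addrA deviationD.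
apply: (le_trans (sqn_jensen _ t01 (sqn_ge0 _) cG)); rewrite -addrA lerD2l.
have hE : sqn E <= 2 * tg ^+ 2 * b ^+ 2 * (sqn es + sqn zeta).
  rewrite /E !sqnZ.
  have -> : 2 * tg ^+ 2 * b ^+ 2 * (sqn es + sqn zeta) =
    tg ^+ 2 * (b ^+ 2 * (2 * (sqn zeta + sqn es))) by ring.
  rewrite !ler_wpM2l ?sqr_ge0 // (le_trans (sqn_le2 _ _)) // sqnN.
  by rewrite ler_wpM2l // lerD2r sqn_offdiag.
have hD : sqn D <= L ^+ 2 * sqn (x' - x) by apply: gradmx_lip.
rewrite ler_pdivrMl //; apply: (le_trans (sqn_deviation_le _)).
apply: (le_trans (sqn_le2 _ _)).
have -> : tg * eta * (4 * tg / eta * b ^+ 2 * (sqn es + sqn zeta) +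
    2 * L ^+ 2 / (tg * eta) * sqn (x' - x)) =
  2 * (2 * tg ^+ 2 * b ^+ 2 * (sqn es + sqn zeta) + L ^+ 2 * sqn (x' - x)).
  by field; rewrite !gt_eqF.
by rewrite ler_wpM2l // lerD.
Qed.

Lemma step_x : sqn (deviation x') <= (1 - g * eta) * sqn (deviation x)
  + 2 * c1 * a / eta * sqn ex + 2 * a / (c1 * eta) * sqn (deviation y).
Proof.
have /andP[g0 g1] := g01; have gc : 0 <= g <= 1 by rewrite ltW.
set G := (1 - g) *: x + g *: (W *m x).
have cG : sqn (deviation G) <= (1 - g * eta) ^+ 2 * sqn (deviation x).
  exact: (gossip_contract n0 Wrow Wcol Weta gc erefl).
have t01 := mulr01 g01 eta01; have /andP[t0 t1] := t01.
rewrite x'E -/G -addrA deviationD.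
apply: (le_trans (sqn_jensen _ t01 (sqn_ge0 _) cG)); rewrite -addrA lerD2l.
rewrite deviationD -scaleNr !deviationZ ler_pdivrMl //.
apply: (le_trans (sqn_le2 _ _)); rewrite !sqnZ sqrrN gE.
have -> : c1 * a * eta * (2 * c1 * a / eta * sqn ex
    + 2 * a / (c1 * eta) * sqn (deviation y)) =
  2 * ((c1 * a) ^+ 2 * sqn ex + a ^+ 2 * sqn (deviation y)).
  by field; rewrite !gt_eqF.
by rewrite ler_wpM2l // lerD2r ler_wpM2l ?sqr_ge0 ?sqn_deviation_le.
Qed.

Lemma xbarE : avgrow x' = avgrow x - a *: u.
Proof.
rewrite x'E !(avgrowD, avgrowN, avgrowZ) avgrow_gossip // -scalerDl subrK scale1r.
by apply/rowP => l; rewrite /u gE !mxE; ring.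
Qed.

(** The mean and the deviation of the displacement are orthogonal, so the mean
    part carries the factor 1 and no factor from a three-term splitting; the
    negative multiple of [sqn u] in [step_f] has to pay for it. *)
Lemma step_dx : sqn (x' - x) <= n%:R * a ^+ 2 * sqn u
  + 3 * (g ^+ 2 * sqn (W - 1%:M) * sqn (deviation x)
         + g ^+ 2 * sqn ex + a ^+ 2 * sqn (deviation y)).
Proof.
rewrite (sqn_split n0) sqn_avgmx -mulrA; apply: lerD.
  rewrite avgrowD avgrowN xbarE // addrAC subrr add0r sqnN sqnZ.
  by rewrite ler_wpM2l ?ler0n.
have -> : x' - x - J *m (x' - x) =
    g *: deviation ((W - 1%:M) *m deviation x) + g *: deviation ex + (- a) *: deviation y.
  rewrite -[LHS]/(deviation (x' - x)) -!deviationZ -!deviationD; congr deviation.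
  rewrite x'E /deviation mulmxBr 2!mulmxBl !mul1mx gossip_avg // subrr subr0.
  by apply/matrixP => i l; rewrite !mxE; ring.
apply: (le_trans (sqn_le3 _ _ _)); rewrite ler_wpM2l // !sqnZ sqrrN.
rewrite -mulrA !lerD // ler_wpM2l ?sqr_ge0 ?sqn_deviation_le //.
by rewrite (le_trans (sqn_deviation_le _)) ?sqn_mulmx.
Qed.

Let F v := favg f v - fstar f.
Let G := grad (favg f) (avgrow x).

Lemma step_u : sqn (G - u) <= 3 * (L ^+ 2 / n%:R * sqn (deviation x)
   + tg ^+ 2 / n%:R * sqn es + c1 ^+ 2 / n%:R * sqn ex).
Proof.
have -> : G - u = (G - avgrow (gradmx f x)) + (- tg) *: avgrow es
    + c1 *: avgrow ex.
  by rewrite /u ybar scaleNr; apply/rowP => l; rewrite !mxE; ring.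
apply: (le_trans (sqn_le3 _ _ _)); rewrite ler_wpM2l //.
rewrite [sqn (- tg *: _)]sqnZ [sqn (c1 *: _)]sqnZ sqrrN.
apply: lerD; first apply: lerD.
- by have := grad_consensus n0 L0 fL x; rewrite -/(deviation x) -/G.
- by rewrite -mulrA ler_wpM2l ?sqr_ge0 ?sqn_avgrow.
- by rewrite -mulrA ler_wpM2l ?sqr_ge0 ?sqn_avgrow.
Qed.

(** Writing - 2 <G, u> = |G - u|^2 - |G|^2 - |u|^2 keeps all of - |G|^2 for the
    Polyak-Lojasiewicz inequality, hence the full rate mu. *)
Lemma step_f : F (avgrow x') <= (1 - a * mu) * F (avgrow x)
  + 3 / 2 * a * (L ^+ 2 / n%:R * sqn (deviation x)
   + tg ^+ 2 / n%:R * sqn es + c1 ^+ 2 / n%:R * sqn ex)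
  + (L * a ^+ 2 - a) / 2 * sqn u.
Proof.
have := descent (avgrow x) (- a *: u) L0 (smooth_favg n0 L0 fL).
rewrite scaleNr -xbarE // -scaleNr frobZr sqnZ sqrrN -/G => h1.
have h2 : 2 * frob G u = sqn G + sqn u - sqn (G - u).
  by rewrite sqnD sqnN frobNr; ring.
have h3 := ler_wpM2l (ltW a0) step_u.
have h4 := ler_wpM2l (ltW a0) (polyak_lojasiewicz fmu (avgrow x)).
have h5 : a * (2 * frob G u) = a * (sqn G + sqn u - sqn (G - u)) by rewrite h2.
by rewrite /F -/G in h4 *; lra.
Qed.

(** A bound on u that does not rely on a small step. *)
Lemma step_grad : sqn u <= 4 * (L + 1) * F (avgrow x)
  + 6 * (L ^+ 2 / n%:R * sqn (deviation x)
   + tg ^+ 2 / n%:R * sqn es + c1 ^+ 2 / n%:R * sqn ex).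
Proof.
have -> : u = G + (u - G) by rewrite addrC subrK.
have := sqn_le2 G (u - G); rewrite (sqnBC u).
have := step_u; have := grad_favg_le n0 L0 fL fmu (avgrow x).
by rewrite -/G /F; lra.
Qed.

(** The sum of [step_y], [step_x] and [step_f], with [step_dx] inserted in
    [step_y].  For small a the coefficient of [sqn u] is negative. *)
Lemma step_all :
  sqn (deviation y') + sqn (deviation x') + F (avgrow x') <=
    (1 - tg * eta + 2 * a / (c1 * eta) + 6 * (L ^+ 2 / (tg * eta)) * a ^+ 2)
      * sqn (deviation y)
  + (1 - g * eta + 3 / 2 * a * (L ^+ 2 / n%:R)
       + 6 * (L ^+ 2 / (tg * eta)) * g ^+ 2 * sqn (W - 1%:M)) * sqn (deviation x)
  + (1 - a * mu) * F (avgrow x)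
  + (2 * c1 * a / eta + 3 / 2 * a * (c1 ^+ 2 / n%:R)
       + 6 * (L ^+ 2 / (tg * eta)) * g ^+ 2) * sqn ex
  + 3 / 2 * a * (tg ^+ 2 / n%:R) * sqn es
  + 4 * tg / eta * b ^+ 2 * (sqn es + sqn zeta)
  + (2 * (L ^+ 2 / (tg * eta)) * n%:R * a ^+ 2 + (L * a ^+ 2 - a) / 2) * sqn u.
Proof.
have /andP[tg0 tg1] := tg01.
have K0 : 0 <= 2 * L ^+ 2 / (tg * eta).
  by rewrite divr_ge0 ?mulr_ge0 ?sqr_ge0 // ltW.
have h1 := step_y; have h2 := step_x; have h3 := step_f.
have h4 := ler_wpM2l K0 step_dx.
by lra.
Qed.

End OneStep.

Section Recursion.
Context {R : realType} {n d : nat}.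
Variables (f : 'I_n -> 'rV[R]_d -> R) (L mu : R) (W : 'M[R]_n) (eta : R).
Variables (tg c1 : R).
Hypothesis n0 : (0 < n)%N.
Hypothesis L0 : 0 <= L.
Hypothesis fL : forall i, smooth L (f i).
Hypothesis fmu : strongly_convex mu (favg f).
Hypothesis Wrow : W *m ones n = ones n.
Hypothesis Wcol : (ones n)^T *m W = (ones n)^T.
Hypothesis W_ge0 : forall i j, 0 <= W i j.
Hypothesis Weta : contraction_constant W eta.
Hypothesis tg01 : 0 < tg <= 1.
Hypothesis c10 : 0 < c1.

Definition iteration (a b : R) (x y ex es x' y' zeta : 'M[R]_(n, d)) : Prop :=
  [/\ x' = (1 - c1 * a) *: x + (c1 * a) *: (W *m x) + (c1 * a) *: ex - a *: y,
      y' = (1 - tg) *: y + tg *: (W *m y)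
        + tg *: (b *: (offdiag W *m zeta - es)) + (gradmx f x' - gradmx f x)
    & avgrow y = tg *: avgrow es + avgrow (gradmx f x)].

(** The Lyapunov function, as a function of the current x and increment y. *)
Definition merit (x y : 'M[R]_(n, d)) : R :=
  sqn (deviation y) + sqn (deviation x) + (favg f (avgrow x) - fstar f).

Lemma merit_ge0 x y : 0 <= merit x y.
Proof. by rewrite addr_ge0 ?subr_ge0 ?(fstar_le fmu) // addr_ge0 ?sqn_ge0. Qed.

Let K := L ^+ 2 / (tg * eta).

Let tg0 : 0 < tg. Proof. by case/andP: tg01. Qed.
Let eta0 : 0 < eta. Proof. by have [/andP[]] := Weta. Qed.

Let K0 : 0 <= K.
Proof. by rewrite divr_ge0 ?sqr_ge0 // ltW // mulr_gt0. Qed.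

Let kappaE : kappaD L tg eta = 10 * K + 30 * L ^+ 2.
Proof. by rewrite /kappaD /K mulrA. Qed.

Lemma kappaD_ge0 : 0 <= kappaD L tg eta.
Proof. by rewrite kappaE; have := (K0, sqr_ge0 L) => -[]; lra. Qed.

Lemma tdeltaD_ge0 : 0 <= tdeltaD W L tg eta c1.
Proof. by rewrite /tdeltaD mulr_ge0 ?kappaD_ge0 // le_max ler01. Qed.

(** [tau_cx] and [tau_cs] are the coefficients of cx and cs in [tauD]. *)
Definition tau_cx : R := kappaD L tg eta * c1 ^+ 2 + 2 * c1 / eta + 10 * c1 ^+ 2 / n%:R.
Definition tau_cs (a1 : R) := 10 * tg * (a1 * L ^+ 2 / eta + tg / n%:R).

(** When a is not small the coefficient of [sqn u] in [step_all] may be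
    positive; [step_grad] then trades u for the merit and the errors.  The
    constant is immaterial: the bound serves to propagate finiteness of the
    expectations. *)
Lemma crude_step a b : 0 < a -> 0 < c1 * a <= 1 -> exists2 C : R, 0 <= C &
  forall x y ex es x' y' zeta, iteration a b x y ex es x' y' zeta ->
  merit x' y' <= C * (merit x y + sqn ex + sqn es + sqn zeta).
Proof.
move=> a0 g01.
pose cA : R := 1 - tg * eta + 2 * a / (c1 * eta) + 6 * K * a ^+ 2.
pose cX : R := 1 - c1 * a * eta + 3 / 2 * a * (L ^+ 2 / n%:R)
       + 6 * K * (c1 * a) ^+ 2 * sqn (W - 1%:M).
pose cEx : R := 2 * c1 * a / eta + 3 / 2 * a * (c1 ^+ 2 / n%:R)
       + 6 * K * (c1 * a) ^+ 2.
pose cEs : R := 3 / 2 * a * (tg ^+ 2 / n%:R).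
pose cZ : R := 4 * tg / eta * b ^+ 2.
pose cU : R := 2 * K * n%:R * a ^+ 2 + (L * a ^+ 2 - a) / 2.
pose dF : R := 4 * (L + 1); pose dX : R := 6 * (L ^+ 2 / n%:R).
pose dEs : R := 6 * (tg ^+ 2 / n%:R); pose dEx : R := 6 * (c1 ^+ 2 / n%:R).
have pn (p : R) : 0 <= p ^+ 2 / n%:R by rewrite divr_ge0 ?sqr_ge0.
have dF0 : 0 <= dF by rewrite mulr_ge0 // addr_ge0.
have [dX0 dEs0 dEx0] : [/\ 0 <= dX, 0 <= dEs & 0 <= dEx].
  by rewrite /dX /dEs /dEx; split; rewrite mulr_ge0.
pose D : R := 1 + dF + dX + dEs + dEx.
have D0 : 0 <= D by rewrite !addr_ge0.
pose C : R := `|cA| + `|cX| + `|1 - a * mu| + `|cEx| + `|cEs| + `|cZ| + `|cU| * D.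
exists C => [|x y ex es x' y' zeta [x'E y'E ybar]].
  by rewrite /C !addr_ge0 ?mulr_ge0 ?normr_ge0.
have := step_all n0 L0 fL fmu Wrow Wcol W_ge0 Weta tg01 g01 a0 c10 erefl x'E y'E ybar.
have := step_grad n0 L0 fL fmu ex c1 ybar.
rewrite -/(merit x' y') -/K -/cA -/cX -/cEx -/cEs -/cZ -/cU.
set u := sqn (avgrow y - _); set S := _ + sqn ex + sqn es + sqn zeta.
have F0 : 0 <= favg f (avgrow x) - fstar f by rewrite subr_ge0 (fstar_le fmu).
have [hA hX] := (sqn_ge0 (deviation y), sqn_ge0 (deviation x)).
have [hex [hes hz]] := (sqn_ge0 ex, (sqn_ge0 es, sqn_ge0 zeta)).
have S0 : 0 <= S by have := merit_ge0 x y; rewrite /S; lra.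
have le (p v : R) : 0 <= v <= S -> p * v <= `|p| * S.
  move=> /andP[v0 vS]; apply: (@le_trans _ _ (`|p| * v)).
    by rewrite ler_wpM2r ?ler_norm.
  by rewrite ler_wpM2l.
have le0 (p v : R) : 0 <= p -> 0 <= v <= S -> p * v <= p * S.
  by move=> p0; have := le p v; rewrite ger0_norm.
have [vA vX vF] : [/\ 0 <= sqn (deviation y) <= S, 0 <= sqn (deviation x) <= S
    & 0 <= favg f (avgrow x) - fstar f <= S].
  by rewrite /S /merit; split; apply/andP; split; lra.
have [vex ves vz] : [/\ 0 <= sqn ex <= S, 0 <= sqn es <= S
    & 0 <= sqn es + sqn zeta <= S].
  by rewrite /S /merit; split; apply/andP; split; lra.
move=> hu.
have uS : u <= D * S.
  have := (le0 _ _ dF0 vF, le0 _ _ dX0 vX, le0 _ _ dEs0 ves, le0 _ _ dEx0 vex).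
  move=> [[[l1 l2] l3] l4]; rewrite /D; move: hu.
  by rewrite /dF /dX /dEs /dEx in l1 l2 l3 l4 *; lra.
have hcu : cU * u <= `|cU| * (D * S).
  apply: (@le_trans _ _ (`|cU| * u)); first by rewrite ler_wpM2r ?sqn_ge0 ?ler_norm.
  by rewrite ler_wpM2l.
have := (le cA _ vA, le cX _ vX, le (1 - a * mu) _ vF, le cEx _ vex, le cEs _ ves).
have := le cZ _ vz.
by move=> l6 [[[[l1 l2] l3] l4] l5]; rewrite /C; lra.
Qed.

(** Under the smallness condition the term in [sqn u] of [step_all] is
    nonpositive; each remaining coefficient is compared with one entry of the
    minimum [deltaD] or of the maximum in [tdeltaD].  Since a <= 1, terms in
    a^2 times an error are absorbed in a. *)
Lemma contraction_step a1 a b x y ex es x' y' zeta :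
  0 < a -> a <= a1 -> a <= 1 -> 0 < c1 * a <= 1 -> (L + 4 * K * n%:R) * a <= 1 ->
  iteration a b x y ex es x' y' zeta ->
  merit x' y' <=
    (1 - deltaD n mu tg eta a1 c1 L * a + tdeltaD W L tg eta c1 * a ^+ 2) * merit x y
    + a * (tau_cx * sqn ex + tau_cs a1 * sqn es)
    + 4 * tg / eta * b ^+ 2 * (sqn es + sqn zeta).
Proof.
move=> a0 aa1 a_1 g01 small [x'E y'E ybar].
have a10 := lt_le_trans a0 aa1.
have := step_all n0 L0 fL fmu Wrow Wcol W_ge0 Weta tg01 g01 a0 c10 erefl x'E y'E ybar.
rewrite -/(merit x' y') -/K.
set u := sqn (avgrow y - _).
have F0 : 0 <= favg f (avgrow x) - fstar f by rewrite subr_ge0 (fstar_le fmu).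
have [hA hX] := (sqn_ge0 (deviation y), sqn_ge0 (deviation x)).
have [hex hes] := (sqn_ge0 ex, sqn_ge0 es).
set delta := deltaD _ _ _ _ _ _ _; set td := tdeltaD _ _ _ _ _.
have [d1 d2 d3] : [/\ delta <= mu, delta <= tg * eta / a1 - 2 / (c1 * eta)
    & delta <= c1 * eta - 8 * L ^+ 2 / n%:R].
  by rewrite /delta /deltaD !ge_min !lexx !orbT.
have [t1 t2] : kappaD L tg eta <= td /\
    kappaD L tg eta * (sqn (W - 1%:M) * c1 ^+ 2) <= td.
  split; last by rewrite ler_wpM2l ?kappaD_ge0 // fnorm_sq le_max lexx orbT.
  by rewrite ler_peMr ?kappaD_ge0 // le_max lexx.
have a2 : a ^+ 2 <= a by rewrite expr2 ler_piMr // ltW.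
have sa2 := sqr_ge0 a; have sL := sqr_ge0 L; have sw := sqn_ge0 (W - 1%:M).
have nL : 0 <= L ^+ 2 / n%:R by rewrite divr_ge0.
have nc : 0 <= c1 ^+ 2 / n%:R by rewrite divr_ge0 ?sqr_ge0.
have nt : 0 <= tg ^+ 2 / n%:R by rewrite divr_ge0 ?sqr_ge0.
have k6 : 6 * K <= kappaD L tg eta by rewrite kappaE; have := K0; lra.
have cA : 1 - tg * eta + 2 * a / (c1 * eta) + 6 * K * a ^+ 2 <= 1 - delta * a + td * a ^+ 2.
  have e1 : tg * eta / a1 * a <= tg * eta.
    by rewrite mulrAC ler_pdivrMr // ler_wpM2l // ltW // mulr_gt0.
  have e2 := ler_wpM2r (ltW a0) d2.
  have e3 := ler_wpM2r sa2 (le_trans k6 t1).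
  have e4 : 2 * a / (c1 * eta) = 2 / (c1 * eta) * a by rewrite mulrAC.
  by rewrite e4; lra.
have cX : 1 - c1 * a * eta + 3 / 2 * a * (L ^+ 2 / n%:R)
       + 6 * K * (c1 * a) ^+ 2 * sqn (W - 1%:M) <= 1 - delta * a + td * a ^+ 2.
  have e1 := ler_wpM2r (ltW a0) d3.
  have e2 : 6 * K * (sqn (W - 1%:M) * c1 ^+ 2) <= td.
    by rewrite (le_trans _ t2) // ler_wpM2r // mulr_ge0 ?sqr_ge0.
  have e3 := ler_wpM2r sa2 e2.
  have e4 := mulr_ge0 (ltW a0) nL.
  by lra.
have cF : 1 - a * mu <= 1 - delta * a + td * a ^+ 2.
  have e1 := ler_wpM2r (ltW a0) d1.
  have e2 : 0 <= td * a ^+ 2 by rewrite mulr_ge0 ?sqr_ge0 ?tdeltaD_ge0.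
  by lra.
have cEx : 2 * c1 * a / eta + 3 / 2 * a * (c1 ^+ 2 / n%:R)
       + 6 * K * (c1 * a) ^+ 2 <= a * tau_cx.
  have e1 := ler_wpM2r (sqr_ge0 (c1 * a)) k6.
  have e2 : kappaD L tg eta * c1 ^+ 2 * a ^+ 2 <= kappaD L tg eta * c1 ^+ 2 * a.
    by rewrite ler_wpM2l // mulr_ge0 ?sqr_ge0 ?kappaD_ge0.
  have e3 := mulr_ge0 (ltW a0) nc.
  rewrite /tau_cx; lra.
have cEs : 3 / 2 * a * (tg ^+ 2 / n%:R) <= a * tau_cs a1.
  have e1 : 0 <= a * (tg * (a1 * L ^+ 2 / eta)).
    by rewrite !(mulr_ge0, invr_ge0) // ltW.
  have e2 := mulr_ge0 (ltW a0) nt.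
  rewrite /tau_cs; lra.
have cU : 2 * K * n%:R * a ^+ 2 + (L * a ^+ 2 - a) / 2 <= 0.
  by have := ler_wpM2r (ltW a0) small; lra.
have u0 : (2 * K * n%:R * a ^+ 2 + (L * a ^+ 2 - a) / 2) * u <= 0.
  by rewrite mulr_le0_ge0 // sqn_ge0.
have := (ler_wpM2r hA cA, ler_wpM2r hX cX, ler_wpM2r F0 cF).
have := (ler_wpM2r hex cEx, ler_wpM2r hes cEs).
rewrite /merit => -[l1 l2] [[l3 l4] l5]; lra.
Qed.

End Recursion.

(** * Scalar recursions of Chung type *)

Section Sequences.
Context {R : realType}.
Implicit Types (u v a : nat -> R).

(** Finitely many exceptions only enlarge the constant. *)
Lemma eventual_bound u v D K : (forall k, (1 <= k)%N -> 0 < u k) ->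
  (forall k, (K <= k)%N -> v k <= D * u k) ->
  exists2 D', 0 < D' & forall k, (1 <= k)%N -> v k <= D' * u k.
Proof.
move=> u0; elim: K D => [|K IH] D vD.
  exists (`|D| + 1) => [|k k1]; first by rewrite ltr_wpDl.
  rewrite (le_trans (vD k _)) // ler_wpM2r ?(ltW (u0 _ _)) //.
  by rewrite (le_trans (ler_norm D)) // lerDl.
have [K0|K1] := posnP K.
  exists (`|D| + 1) => [|k k1]; first by rewrite ltr_wpDl.
  rewrite (le_trans (vD k _)) ?K0 // ler_wpM2r ?(ltW (u0 _ _)) //.
  by rewrite (le_trans (ler_norm D)) // lerDl.
apply: (IH (Num.max D (v K / u K))) => k; rewrite leq_eqVlt => /predU1P[<-|Kk].
  by rewrite -ler_pdivrMr ?u0 // le_max lexx orbT.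
rewrite (le_trans (vD k Kk)) // ler_wpM2r ?le_max ?lexx //.
by rewrite ltW // u0 // (leq_trans _ Kk).
Qed.

(** If D >= C / eps, then v k <= D u k gives
    v (k+1) <= (1 - a) D u + C a u <= D (1 - (1 - eps) a) u <= D u (k+1):
    the bound propagates as soon as u decreases more slowly than the
    contraction by a fixed proportion. *)
Lemma chung u v a C eps K : (forall k, (1 <= k)%N -> 0 < u k) -> 0 < eps ->
  (forall k, (K <= k)%N -> 0 <= a k <= 1) ->
  (forall k, (K <= k)%N -> (1 - (1 - eps) * a k) * u k <= u k.+1) ->
  (forall k, (K <= k)%N -> v k.+1 <= (1 - a k) * v k + C * a k * u k) ->
  exists2 D, 0 < D & forall k, (1 <= k)%N -> v k <= D * u k.
Proof.
move=> u0 eps0 a01 uS vS.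
pose K' := K.+1; pose D := Num.max (C / eps) (Num.max 0 (v K' / u K')).
apply: (@eventual_bound _ _ D K') => //.
have D0 : 0 <= D by rewrite !le_max lexx orbT.
have CD : C <= eps * D by rewrite mulrC -ler_pdivrMr // le_max lexx.
elim=> // k IH; rewrite leq_eqVlt => /predU1P[<-|Kk].
  by rewrite -ler_pdivrMr ?u0 // !le_max lexx !orbT.
have Kk' : (K <= k)%N by rewrite -ltnS ltnW.
have /andP[a0 a1] := a01 k Kk'.
have uk : 0 < u k by apply: u0; exact: (leq_trans (ltn0Sn K)).
apply: (le_trans (vS k Kk')).
have h1 : (1 - a k) * v k <= (1 - a k) * (D * u k) by rewrite ler_wpM2l ?subr_ge0 ?IH.
have h2 : C * a k * u k <= eps * D * a k * u k.
  by rewrite ler_wpM2r ?(ltW uk) // ler_wpM2r.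
have h3 := ler_wpM2l D0 (uS k Kk').
by lra.
Qed.

Lemma natr_pow_ge (p M : R) : 0 < p ->
  exists2 K, (1 <= K)%N & forall k, (K <= k)%N -> M <= k%:R `^ p.
Proof.
move=> p0; pose r := Num.max M 1.
have r0 : 0 < r by rewrite lt_max ltr01 orbT.
exists (Num.bound (r `^ p^-1)).+1 => // k Kk.
have h : r `^ p^-1 <= k%:R.
  rewrite (le_trans (ltW (archi_boundP (powR_ge0 r p^-1)))) // ler_nat.
  exact: ltnW.
have : (r `^ p^-1) `^ p <= k%:R `^ p.
  by rewrite ge0_ler_powR ?nnegrE ?powR_ge0 // ltW.
rewrite -powRrM mulVf ?gt_eqF // powRr1 ?(ltW r0) // => rk.
by rewrite (le_trans _ rk) // le_max lexx.
Qed.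

Lemma inv_pow_gt0 (b : R) k : (1 <= k)%N -> 0 < inv_pow b k.
Proof. by move=> k1; rewrite divr_gt0 // powR_gt0 // ltr0n. Qed.

(** Because (1 + 1/k)^b <= 1 + 1/k for b <= 1. *)
Lemma inv_powS (b : R) k : b <= 1 -> (1 <= k)%N ->
  (1 - k%:R^-1) * inv_pow b k <= inv_pow b k.+1.
Proof.
move=> b1 k1; have k0 : 0 < k%:R :> R by rewrite ltr0n.
have pk : 0 < k%:R `^ b :> R by rewrite powR_gt0.
have h : k.+1%:R `^ b <= k%:R `^ b * (1 + k%:R^-1).
  have -> : k.+1%:R = k%:R * (1 + k%:R^-1) :> R.
    by rewrite -natr1; field; rewrite gt_eqF.
  have i0 : 0 <= k%:R^-1 :> R by rewrite invr_ge0 ltW.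
  rewrite powRM ?(ltW k0) ?addr_ge0 // ler_wpM2l ?(ltW pk) //.
  rewrite -[leRHS]powRr1; last by rewrite addr_ge0.
  by rewrite ler_powR // lerDl.
have pk1 : 0 < k.+1%:R `^ b :> R by rewrite powR_gt0 // ltr0n.
rewrite /inv_pow !mul1r ler_pdivrMr // mulrC ler_pdivlMr //.
have [z1|z1] := leP (1 - k%:R^-1 : R) 0.
  by apply: le_trans (ltW pk); rewrite mulr_le0_ge0 // ltW.
have := ler_wpM2l (ltW z1) h.
have : 0 <= k%:R `^ b * k%:R^-1 ^+ 2 by rewrite mulr_ge0 ?sqr_ge0 // ltW.
by lra.
Qed.

Lemma inv_nat_small (b c : R) : b < 1 -> 0 < c ->
  exists2 K, (1 <= K)%N & forall k, (K <= k)%N -> k%:R^-1 <= c * inv_pow b k.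
Proof.
move=> b1 c0.
have b1' : 0 < 1 - b by rewrite subr_gt0.
have [K K1 Kk] := natr_pow_ge c^-1 b1'.
exists K => // k kK; have := Kk k kK.
have k0 : 0 < k%:R :> R by rewrite ltr0n (leq_trans K1).
rewrite powRB ?(gt_eqF k0) ?implybT // powRr1 ?(ltW k0) // => h.
have pk : 0 < k%:R `^ b :> R by rewrite powR_gt0.
have := ler_wpM2r (divr_ge0 (ltW c0) (ltW k0)) h.
have -> : c^-1 * (c / k%:R) = k%:R^-1 by field; rewrite !gt_eqF.
by have -> : k%:R / k%:R `^ b * (c / k%:R) = c * inv_pow b k
  by rewrite /inv_pow; field; rewrite !gt_eqF.
Qed.

Lemma inv_pow_small (b c : R) : 0 < b -> 0 < c ->
  exists2 K, (1 <= K)%N & forall k, (K <= k)%N -> inv_pow b k <= c.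
Proof.
move=> b0 c0.
have [K K1 Kk] := natr_pow_ge c^-1 b0.
exists K => // k kK; have := Kk k kK.
have k0 : 0 < k%:R :> R by rewrite ltr0n (leq_trans K1).
by rewrite /inv_pow mul1r invf_ple // ?posrE ?powR_gt0 // invr_gt0.
Qed.

(** For b < 1 the relative decrease of k^(-b), at most 1/k, is negligible
    against a contraction of order k^(-b). *)
Lemma chung_pow (b c C : R) v a K : 0 < b < 1 -> 0 < c ->
  (forall k, (K <= k)%N -> c * inv_pow b k <= a k <= 1) ->
  (forall k, (K <= k)%N -> v k.+1 <= (1 - a k) * v k + C * a k * inv_pow b k) ->
  exists2 D, 0 < D & forall k, (1 <= k)%N -> v k <= D * inv_pow b k.
Proof.
move=> /andP[b0 b1] c0 ac vS.
have [K' K'1 hK'] := inv_nat_small b1 (divr_gt0 c0 (ltr0Sn R 1)).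
apply: (@chung _ _ a C 2^-1 (maxn K K')) => [k k1||k|k|k].
- exact: inv_pow_gt0.
- by rewrite invr_gt0.
- rewrite geq_max => /andP[Kk Kk']; have /andP[ca ->] := ac k Kk.
  rewrite andbT (le_trans _ ca) // mulr_ge0 ?(ltW (inv_pow_gt0 _ _)) ?ltW //.
  exact: leq_trans Kk'.
- rewrite geq_max => /andP[Kk Kk']; have /andP[ca _] := ac k Kk.
  have k1 : (1 <= k)%N := leq_trans K'1 Kk'.
  apply: le_trans (inv_powS (ltW b1) k1).
  rewrite ler_wpM2r ?(ltW (inv_pow_gt0 _ _)) //.
  by have := hK' k Kk'; lra.
- by rewrite geq_max => /andP[Kk _]; exact: vS.
Qed.

(** Here the relative decrease 1 / (k + a1 + 1) of the comparison sequence is of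
    the same order as the contraction p / (k + a1); p > 1 leaves the proportion
    1 - 1/p. *)
Lemma chung_harmonic (p a1 C : R) v K : 0 <= a1 -> 1 < p ->
  (forall k, (K <= k)%N ->
     v k.+1 <= (1 - p / (k%:R + a1)) * v k + C / (k%:R + a1) ^+ 2) ->
  exists2 D, 0 < D & forall k, (1 <= k)%N -> v k <= D * (k%:R + a1)^-1.
Proof.
move=> a10 p1 vS; have p0 : 0 < p := lt_trans ltr01 p1.
have m0 k : (1 <= k)%N -> 0 < k%:R + a1 by move=> k1; rewrite ltr_wpDr // ltr0n.
pose K' := maxn (maxn K 1) (Num.bound p).
have mK k : (K' <= k)%N -> [/\ (K <= k)%N, 0 < k%:R + a1 & p <= k%:R + a1].
  rewrite !geq_max -andbA => /and3P[Kk k1 pk]; split; rewrite ?m0 //.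
  rewrite ler_wpDr // (le_trans (ltW (archi_boundP (ltW p0)))) // ler_nat //.
apply: (@chung _ _ (fun k => p / (k%:R + a1)) (C / p) (1 - p^-1) K') => [k k1||k|k|k].
- by rewrite invr_gt0 m0.
- by rewrite subr_gt0 invf_lt1.
- by move=> /mK[_ mk pk]; rewrite divr_ge0 ?(ltW p0) ?(ltW mk) //= ler_pdivrMr // mul1r.
- move=> /mK[_ mk pk]; set m := k%:R + a1 in mk pk *.
  have -> : k.+1%:R + a1 = m + 1 by rewrite -natr1 /m; ring.
  have -> : (1 - (1 - (1 - p^-1)) * (p / m)) / m = (m - 1) / m ^+ 2.
    by field; rewrite !gt_eqF.
  have m1 : 0 < m + 1 by rewrite addr_gt0.
  by rewrite ler_pdivrMr ?exprn_gt0 // ler_pdivlMl //; lra.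
- move=> /mK[Kk mk pk]; apply: (le_trans (vS k Kk)); rewrite lerD2l.
  rewrite le_eqVlt; apply/orP; left; apply/eqP.
  by field; rewrite !gt_eqF.
Qed.

End Sequences.

(** * Orthogonality from vanishing conditional means *)

Section CenteredVariables.
Context {R : realType} {disp : measure_display} {T : measurableType disp}.
Variable P : probability T R.
Implicit Types X Y : T -> R.

Definition centered X : Prop :=
  P.-integrable setT (EFin \o X) /\ (\int[P]_w (X w)%:E = 0)%E.

Lemma centeredD X Y : centered X -> centered Y -> centered (fun w => X w + Y w).
Proof.
move=> [iX X0] [iY Y0]; split; first exact: (integrableD measurableT iX iY).
have e := integralD measurableT iX iY.
by rewrite /= X0 Y0 adde0 in e.
Qed.

Lemma centeredZ c X : centered X -> centered (fun w => c * X w).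
Proof.
move=> [iX X0]; split; first exact: (integrableZl measurableT c iX).
have e := integralZl measurableT iX c.
by rewrite /= X0 mule0 in e.
Qed.

Lemma centered_cst0 : centered (fun=> 0).
Proof. by split; [exact: integrable0|rewrite integral0]. Qed.

Lemma centered_sum (I : Type) (r : seq I) (F : I -> T -> R) :
  (forall i, centered (F i)) -> centered (fun w => \sum_(i <- r) F i w).
Proof.
move=> cF; elim: r => [|i r IH].
  by under eq_fun do rewrite big_nil; exact: centered_cst0.
by under eq_fun do rewrite big_cons; exact: centeredD.
Qed.

Lemma centered_indic A Y : measurable A -> P.-integrable setT (EFin \o Y) ->
  (\int[P]_(w in A) (Y w)%:E = 0)%E -> centered (fun w => \1_A w * Y w).
Proof.
move=> mA iY YA; split.
  have e : EFin \o (fun w => \1_A w * Y w) = ((EFin \o Y) \_ A).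
    by apply/funext => w; rewrite epatch_indic /= -EFinM mulrC.
  rewrite e; apply/integrable_restrict => //; rewrite setTI.
  exact: integrableS iY.
rewrite -[RHS]YA [RHS]integral_mkcond; apply: eq_integral => w _.
by rewrite epatch_indic /= -EFinM mulrC.
Qed.

Variables X Y : T -> R.
Hypothesis mX : measurable_fun setT X.
Hypothesis iY : P.-integrable setT (EFin \o Y).
Hypothesis XY : forall B : set R, measurable B ->
  (\int[P]_(w in X @^-1` B) (Y w)%:E = 0)%E.

Import HBNNSimple.

(** A simple function of X is a finite combination of indicators of events
    {X in B}, on each of which Y integrates to 0. *)
Lemma centered_simple (g : {nnsfun R >-> R}) : centered (fun w => g (X w) * Y w).
Proof.
rewrite (_ : (fun w => _) = fun w => \sum_(r <- finmap.enum_fset (fset_set (range g)))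
   r * (\1_(X @^-1` (g @^-1` [set r])) w * Y w)).
  apply: centered_sum => r; apply: centeredZ.
  have mg : measurable (g @^-1` [set r]) by exact: measurable_sfunP.
  apply: centered_indic => //; last exact: XY.
  by rewrite -[_ @^-1` _]setTI; exact: mX.
apply/funext => w; rewrite fimfunE fsbig_finite //= big_distrl /=.
by apply: eq_bigr => r _; rewrite mulrA.
Qed.

(** Increasing simple approximations of h, composed with X, are dominated by
    h(X) and converge to it. *)
Lemma centered_comp (h : R -> R) : measurable_fun setT h -> (forall x, 0 <= h x) ->
  P.-integrable setT (EFin \o (fun w => h (X w) * Y w)) ->
  centered (fun w => h (X w) * Y w).
Proof.
move=> mh h0 ihXY; split=> //.
have mEh := (measurable_EFinP setT h).2 mh.
pose g := nnsfun_approx measurableT mEh.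
have gh x : EFin \o (g^~ x) @ \oo --> (h x)%:E.
  by apply: (@cvg_nnsfun_approx _ _ _ _ measurableT _ mEh) => // t _; rewrite lee_fin.
have gle n x : g n x <= h x.
  rewrite -lee_fin /g nnsfun_approxE.
  have := @le_approx _ _ _ setT (EFin \o h) n x.
  by apply => // t _; rewrite lee_fin.
have g0 n : (\int[P]_w (g n (X w) * Y w)%:E = 0)%E by case: (centered_simple (g n)).
have [|||||] := @dominated_convergence _ _ _ P setT measurableT
  (fun n w => (g n (X w) * Y w)%:E) (fun w => (h (X w) * Y w)%:E)
  (fun w => `|(h (X w) * Y w)%:E|%E).
- move=> n; have [/measurable_int + _] := centered_simple (g n); exact.
- exact: measurable_int ihXY.
- apply: aeW => w _; under eq_fun do rewrite EFinM; rewrite EFinM.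
  by apply: cvgeZr => //; exact: gh.
- exact: integrable_abse.
- apply: aeW => w n _; rewrite !abse_EFin lee_fin !normrM.
  by rewrite ler_wpM2r // !ger0_norm.
move=> _ _; under eq_fun do rewrite g0.
by move=> /(cvg_unique _ (cvg_cst _)) => /(_ (@ereal_hausdorff R)) <-.
Qed.

(** If Y integrates to 0 over every event determined by X, that is, if the
    conditional mean of Y given X vanishes, then X and Y are orthogonal. *)
Lemma centered_mul : P.-integrable setT (EFin \o (fun w => X w * Y w)) ->
  centered (fun w => X w * Y w).
Proof.
move=> iXY.
have mp : measurable_fun setT (fun x : R => Num.max x 0).
  by apply: measurable_maxr => //; exact: measurable_cst.
have mn : measurable_fun setT (fun x : R => Num.max (- x) 0).
  by apply: measurable_maxr => //; exact: measurable_cst.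
have dom (h : R -> R) : measurable_fun setT h -> (forall x, `|h x| <= `|x|) ->
    P.-integrable setT (EFin \o (fun w => h (X w) * Y w)).
  move=> mh hx; apply: le_integrable iXY => //.
    apply/measurable_EFinP; apply: measurable_funM.
      exact: (measurableT_comp mh).
    by apply/measurable_EFinP; exact: measurable_int iY.
  by move=> w _; rewrite /= lee_fin !normrM ler_wpM2r.
have c1 : centered (fun w => Num.max (X w) 0 * Y w).
  apply: (@centered_comp (fun x => Num.max x 0)) => // [x|].
    by rewrite le_max lexx orbT.
  by apply: (dom (fun x => Num.max x 0)) => // x; case: (leP x 0) => //; rewrite normr0.
have c2 : centered (fun w => Num.max (- X w) 0 * Y w).
  apply: (@centered_comp (fun x => Num.max (- x) 0)) => // [x|].
    by rewrite le_max lexx orbT.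
  apply: (dom (fun x => Num.max (- x) 0)) => // x.
  by case: (leP (- x) 0) => //; rewrite ?normr0 ?normrN.
have := centeredD c1 (centeredZ (-1) c2); congr centered.
apply/funext => w; rewrite mulN1r -mulrBl; congr (_ * _).
by case: (leP (X w) 0); case: (leP (- X w) 0); lra.
Qed.

End CenteredVariables.

(** * Upper bounds on expectations *)

Section MeanBounds.
Context {R : realType} {disp : measure_display} {T : measurableType disp}.
Variable P : probability T R.
Implicit Types X Y : T -> R.

(** Expectations are extended reals.  Bounding them by a real number records
    finiteness, and lets all further estimates take place among reals. *)
Definition mean_le X (r : R) : Prop :=
  [/\ measurable_fun setT X, forall w, 0 <= X w & ('E_P[X] <= r%:E)%E].

Lemma mean_leD X Y r s : mean_le X r -> mean_le Y s ->
  mean_le (fun w => X w + Y w) (r + s).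
Proof.
move=> [mX X0 Xr] [mY Y0 Ys]; split.
- exact: measurable_funD.
- by move=> w; rewrite addr_ge0.
- rewrite unlock; under eq_integral do rewrite EFinD.
  rewrite ge0_integralD //; last 4 first.
  + by move=> w _; rewrite lee_fin.
  + exact/measurable_EFinP.
  + by move=> w _; rewrite lee_fin.
  + exact/measurable_EFinP.
  by rewrite EFinD leeD //; rewrite unlock in Xr Ys.
Qed.

Lemma mean_leZ X r c : 0 <= c -> mean_le X r -> mean_le (fun w => c * X w) (c * r).
Proof.
move=> c0 [mX X0 Xr]; split.
- exact: measurable_funM.
- by move=> w; rewrite mulr_ge0.
- rewrite unlock; under eq_integral do rewrite EFinM.
  rewrite ge0_integralZl_EFin //; last 2 first.
  + by move=> w _; rewrite lee_fin.
  + exact/measurable_EFinP.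
  by rewrite EFinM lee_wpmul2l ?lee_fin //; rewrite unlock in Xr.
Qed.

Lemma mean_le_mono X Y r : measurable_fun setT X -> (forall w, 0 <= X w <= Y w) ->
  mean_le Y r -> mean_le X r.
Proof.
move=> mX XY [mY Y0 Yr]; have X0 w : 0 <= X w by case/andP: (XY w).
split=> //; apply: le_trans Yr; apply: expectation_le => //.
by apply: aeW => w; case/andP: (XY w).
Qed.

Lemma mean_leW X r s : mean_le X r -> r <= s -> mean_le X s.
Proof. by move=> [mX X0 Xr] rs; split=> //; rewrite (le_trans Xr) // lee_fin. Qed.

Lemma mean_le_cst (c : R) : 0 <= c -> mean_le (cst c) c.
Proof. by move=> c0; split=> //; rewrite expectation_cst. Qed.

Lemma mean_le_ge0 X r : mean_le X r -> 0 <= r.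
Proof. by move=> [_ X0 Xr]; rewrite -lee_fin (le_trans _ Xr) // expectation_ge0. Qed.

Lemma mean_le_sum (I : Type) (s : seq I) (F : I -> T -> R) (r : I -> R) :
  (forall i, mean_le (F i) (r i)) ->
  mean_le (fun w => \sum_(i <- s) F i w) (\sum_(i <- s) r i).
Proof.
move=> Fr; elim: s => [|i s IH].
  by under eq_fun do rewrite big_nil; rewrite big_nil; exact: (mean_le_cst (lexx 0)).
by under eq_fun do rewrite big_cons; rewrite big_cons; exact: mean_leD.
Qed.

Definition mean X : R := fine ('E_P[X])%E.

Lemma mean_leP X r : mean_le X r -> mean_le X (mean X) /\ mean X <= r.
Proof.
move=> Xr; have [mX X0 EXr] := Xr.
have EX0 : (0 <= 'E_P[X])%E by exact: expectation_ge0.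
have fin : ('E_P[X])%E \is a fin_num.
  by rewrite ge0_fin_numE // (le_lt_trans EXr) // ltry.
by split; [split=> //; rewrite /mean fineK|rewrite -lee_fin fineK].
Qed.

(** A centered term may be dropped from an expectation; it carries the cross
    terms of a squared norm. *)
Lemma mean_centered X Y Z r s : mean_le X r -> mean_le Y s -> centered P Z ->
  (forall w, 0 <= X w + Z w + Y w) ->
  mean_le (fun w => X w + Z w + Y w) (r + s).
Proof.
move=> [mX X0 Xr] [mY Y0 Ys] [iZ Z0] XYZ.
have int (V : T -> R) (v : R) : measurable_fun setT V -> (forall w, 0 <= V w) ->
    ('E_P[V] <= v%:E)%E -> P.-integrable setT (EFin \o V).
  move=> mV V0 Vv; apply/integrableP; split; first exact/measurable_EFinP.
  under eq_integral do rewrite /= ger0_norm //.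
  by rewrite unlock in Vv; rewrite (le_lt_trans Vv) // ltry.
have iX := int X r mX X0 Xr; have iY := int Y s mY Y0 Ys.
have iXZ := integrableD measurableT iX iZ.
split=> //.
  by apply/measurable_EFinP; exact: measurable_int (integrableD measurableT iXZ iY).
have e1 := integralD measurableT iXZ iY; have e2 := integralD measurableT iX iZ.
rewrite unlock [leLHS]e1 e2 /= Z0 adde0 EFinD leeD //; by rewrite unlock in Xr Ys.
Qed.

Definition square_integrable X : Prop :=
  measurable_fun setT X /\ exists r, mean_le (fun w => X w ^+ 2) r.

Lemma square_integrable_le X Y : measurable_fun setT X -> (exists r, mean_le Y r) ->
  (forall w, X w ^+ 2 <= Y w) -> square_integrable X.
Proof.
move=> mX [r Yr] XY; split=> //; exists r; apply: mean_le_mono Yr => [|w].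
  exact: measurable_funX.
by rewrite sqr_ge0 XY.
Qed.

Lemma square_integrableD X Y : square_integrable X -> square_integrable Y ->
  square_integrable (fun w => X w + Y w).
Proof.
move=> [mX [r Xr]] [mY [s Ys]]; apply: (@square_integrable_le _ (fun w => 2 * (X w ^+ 2 + Y w ^+ 2))).
- exact: measurable_funD.
- by exists (2 * (r + s)); apply: mean_leZ => //; exact: mean_leD.
- by move=> w; have := sqr_ge0 (X w - Y w); lra.
Qed.

Lemma square_integrableZ c X : square_integrable X -> square_integrable (fun w => c * X w).
Proof.
move=> [mX [r Xr]]; apply: (@square_integrable_le _ (fun w => c ^+ 2 * X w ^+ 2)).
- exact: measurable_funM.
- by exists (c ^+ 2 * r); apply: mean_leZ => //; rewrite sqr_ge0.
- by move=> w; rewrite exprMn.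
Qed.

Lemma square_integrable_cst (c : R) : square_integrable (cst c).
Proof. by split=> //; exists (c ^+ 2); exact: (mean_le_cst (sqr_ge0 c)). Qed.

Lemma square_integrable_sum (I : Type) (s : seq I) (F : I -> T -> R) :
  (forall i, square_integrable (F i)) -> square_integrable (fun w => \sum_(i <- s) F i w).
Proof.
move=> Fr; elim: s => [|i s IH].
  by under eq_fun do rewrite big_nil; exact: (square_integrable_cst 0).
by under eq_fun do rewrite big_cons; exact: square_integrableD.
Qed.

Lemma square_integrable_mul X Y : square_integrable X -> square_integrable Y ->
  P.-integrable setT (EFin \o (fun w => X w * Y w)).
Proof.
move=> [mX [r Xr]] [mY [s Ys]]; have [mXY XY0 XYrs] := mean_leD Xr Ys.
apply/integrableP; split.
  by apply/measurable_EFinP; exact: measurable_funM.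
rewrite (@le_lt_trans _ _ (r + s)%:E) ?ltry //; rewrite unlock in XYrs.
apply: le_trans XYrs; apply: ge0_le_integral => //.
- by apply: measurableT_comp => //; apply/measurable_EFinP; exact: measurable_funM.
- exact/measurable_EFinP.
move=> w _; rewrite /= lee_fin normrM.
have := sqr_ge0 (`|X w| - `|Y w|); have := sqr_ge0 (`|X w| + `|Y w|).
by rewrite -(real_normK (num_real (X w))) -(real_normK (num_real (Y w))); lra.
Qed.

End MeanBounds.

(** * Second moments of the sharing errors *)

Section NoiseMoments.
Context {R : realType} {disp : measure_display} {T : measurableType disp}.
Variable P : probability T R.

(** The conditional expectation Y of X has the same total integral as X.  Y is
    at most c almost everywhere only, hence the truncation at c in the proof. *)
Lemma cond_exp_le_mean (F : set (set T)) (X : T -> R) c :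
  F setT -> (forall w, 0 <= X w) -> cond_exp_le P F X c -> mean_le P X c.
Proof.
move=> FT X0 [Y [iX iY _ XY] Yc].
have mX : measurable_fun setT X by apply/measurable_EFinP; exact: measurable_int iX.
have mY : measurable_fun setT Y by apply/measurable_EFinP; exact: measurable_int iY.
split=> //; rewrite unlock XY //.
have mZ : measurable_fun setT (fun w => Num.min (Y w) c).
  by apply: measurable_minr => //; exact: measurable_cst.
have iZ : P.-integrable setT (EFin \o (fun w => Num.min (Y w) c)).
  apply: (@le_integrable _ _ _ P setT measurableT _ (fun w => `|(Y w)%:E| + `|c%:E|)%E).
  - exact/measurable_EFinP.
  - move=> w _; rewrite /= lee_fin [leRHS]ger0_norm ?addr_ge0 //.
    by case: (leP (Y w) c) => _; rewrite ?lerDl ?lerDr normr_ge0.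
  - apply: (integrableD measurableT (integrable_abse iY)).
    exact: (integrable_abse (finite_measure_integrable_cst P c measurableT)).
rewrite (@ae_eq_integral _ _ _ P setT (EFin \o (fun w => Num.min (Y w) c)) (EFin \o Y)) //.
- have -> : c%:E = (\int[P]_(w in setT) (cst c w)%:E)%E.
    by have := expectation_cst P c; rewrite unlock.
  apply: le_integral => //.
    exact: (finite_measure_integrable_cst P c measurableT).
  by move=> w _; rewrite /= lee_fin ge_min lexx orbT.
- exact/measurable_EFinP.
- exact/measurable_EFinP.
- by apply: filterS Yc => w Ywc _ /=; rewrite min_l.
Qed.

Lemma sigma_algebra_setT (G : set (set T)) : <<s G >> setT.
Proof.
move=> A [[A0 AC _] _]; have := AC set0 A0; by rewrite setD0.
Qed.

Lemma measurable_sqn m p (A : T -> 'M[R]_(m, p)) :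
  (forall i j, measurable_fun setT (fun w => A w i j)) ->
  measurable_fun setT (fun w => sqn (A w)).
Proof.
move=> mA; under eq_fun do rewrite sqnE.
apply: measurable_sum => i; apply: measurable_sum => j.
exact: measurable_funX.
Qed.

Lemma measurable_mulmx m p q (M : 'M[R]_(m, p)) (A : T -> 'M[R]_(p, q)) :
  (forall i j, measurable_fun setT (fun w => A w i j)) ->
  forall i j, measurable_fun setT (fun w => (M *m A w) i j).
Proof.
move=> mA i j; under eq_fun do rewrite mxE.
by apply: measurable_sum => k; exact: measurable_funM.
Qed.

(** What the filtration assumptions say about one of the two noises, in terms
    of expectations alone. *)
Record white_noise {n d} (zeta : nat -> T -> 'M[R]_(n, d)) (S : R) : Prop := WhiteNoise {
  wn_square_integrable : forall k i l, (1 <= k)%N -> square_integrable P (fun w => zeta k w i l);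
  wn_mean : forall k, (1 <= k)%N -> mean_le P (fun w => sqn (zeta k w)) S;
  wn_centered : forall k i l, (1 <= k)%N -> centered P (fun w => zeta k w i l);
  wn_orth : forall t k i j l m, (2 <= t < k)%N ->
    centered P (fun w => zeta t w i l * zeta k w j m) }.

(** Earlier noise is measurable with respect to the sigma-algebra given which
    the present noise has mean 0; [centered_mul] then gives orthogonality. *)
Lemma noise_white n d (zeta : nat -> T -> 'M[R]_(n, d)) (F : nat -> set (set T)) sigma :
  (forall k i l, measurable_fun setT (fun w => zeta k w i l)) ->
  (forall k, F k setT) ->
  (forall t k A, (2 <= t < k)%N -> noise_events zeta t A -> F k A) ->
  (forall k i l, (1 <= k)%N -> is_cond_exp P (F k) (fun w => zeta k w i l) (cst 0)) ->
  (forall k i, (1 <= k)%N ->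
     cond_exp_le P (F k) (fun w => fnorm (row i (zeta k w)) ^+ 2) (sigma ^+ 2)) ->
  white_noise zeta (n%:R * sigma ^+ 2).
Proof.
move=> mz FT Fsub z0 z2.
have zrow k i : (1 <= k)%N -> mean_le P (fun w => sqn (row i (zeta k w))) (sigma ^+ 2).
  move=> k1; have := z2 k i k1; under eq_fun do rewrite fnorm_sq.
  by apply: cond_exp_le_mean => // w; exact: sqn_ge0.
have zsq k i l : (1 <= k)%N -> square_integrable P (fun w => zeta k w i l).
  move=> k1; apply: (square_integrable_le (mz k i l)); first by eexists; exact: zrow k i k1.
  move=> w /=; rewrite sqnE big_ord1 (bigD1 l) //= mxE lerDl.
  by apply: sumr_ge0 => ? _; exact: sqr_ge0.
split=> //.
- move=> k k1; under eq_fun do rewrite sqn_row.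
  rewrite -[n in n%:R]card_ord mulr_natl -sumr_const.
  by apply: mean_le_sum => i; exact: zrow.
- move=> k i l k1; have [iz _ _ ze] := z0 k i l k1; split=> //.
  by rewrite ze // integral0_eq.
- move=> t k i j l m /andP[t2 tk].
  have k1 : (1 <= k)%N by rewrite (leq_trans _ (ltnW tk)) // ltnW.
  have [iz _ _ ze] := z0 k j m k1.
  apply: centered_mul => //.
  + move=> B mB; rewrite ze ?integral0_eq //.
    apply: (Fsub t); first by rewrite t2.
    by exists i, l, B; rewrite // setTI.
  + by apply: square_integrable_mul; apply: zsq => //; exact: ltnW.
Qed.

Variables (n d : nat) (zeta : nat -> T -> 'M[R]_(n, d)) (S : R).
Variables (M : 'M[R]_n) (b : nat -> R) (er : nat -> T -> 'M[R]_(n, d)).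
Variable er1 : 'M[R]_(n, d).
Hypothesis zw : white_noise zeta S.
Hypothesis Mle : forall A : 'M[R]_(n, d), sqn (M *m A) <= sqn A.
Hypothesis er1E : forall w, er 1 w = er1.
Hypothesis erS : forall k w, (1 <= k)%N ->
  er k.+1 w = (1 - b k) *: er k w + b k *: (M *m zeta k.+1 w).

Lemma error_entry k w i l : (1 <= k)%N ->
  er k.+1 w i l = (1 - b k) * er k w i l + b k * \sum_q M i q * zeta k.+1 w q l.
Proof. by move=> k1; rewrite erS // !mxE. Qed.

Lemma error_square_integrable k i l : (1 <= k)%N -> square_integrable P (fun w => er k w i l).
Proof.
elim: k => // -[_ _|k IH _].
  by under eq_fun do rewrite er1E; exact: (square_integrable_cst P (er1 i l)).
under eq_fun do rewrite error_entry //.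
apply: square_integrableD; first by apply: square_integrableZ; exact: IH.
apply: square_integrableZ; apply: square_integrable_sum => q.
by apply: square_integrableZ; exact: (wn_square_integrable zw).
Qed.

(** The error at time k is a linear combination of a constant and of the noise
    up to time k. *)
Lemma error_orth k m i j l p : (1 <= k < m)%N ->
  centered P (fun w => er k w i l * zeta m w j p).
Proof.
elim: k => // -[_ /= m1|k IH km].
  by under eq_fun do rewrite er1E; apply: centeredZ; apply: (wn_centered zw); exact: ltnW.
have h w : er k.+2 w i l * zeta m w j p = (1 - b k.+1) * (er k.+1 w i l * zeta m w j p)
    + b k.+1 * \sum_q M i q * (zeta k.+2 w q l * zeta m w j p).
  rewrite error_entry // mulrDl !mulrA; congr (_ + _); rewrite -mulrA; congr (_ * _).
  by rewrite big_distrl; apply: eq_bigr => q _ /=; rewrite mulrA.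
under eq_fun do rewrite h.
apply: centeredD; first by apply: centeredZ; apply: IH; exact: (ltnW km).
by apply: centeredZ; apply: centered_sum => q; apply: centeredZ; exact: (wn_orth zw).
Qed.

(** The cross term of the squared norm is centered by [error_orth]. *)
Lemma error_mean k v : (1 <= k)%N -> mean_le P (fun w => sqn (er k w)) v ->
  mean_le P (fun w => sqn (er k.+1 w)) ((1 - b k) ^+ 2 * v + b k ^+ 2 * S).
Proof.
move=> k1 ev.
have h w : sqn (er k.+1 w) = (1 - b k) ^+ 2 * sqn (er k w)
    + 2 * (1 - b k) * b k * frob (er k w) (M *m zeta k.+1 w)
    + b k ^+ 2 * sqn (M *m zeta k.+1 w).
  by rewrite erS // sqnD !sqnZ frobZl frobZr; ring.
under eq_fun do rewrite h.
apply: mean_centered.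
- by apply: mean_leZ => //; exact: sqr_ge0.
- apply: mean_leZ; first exact: sqr_ge0.
  apply: mean_le_mono (wn_mean zw (ltn0Sn k)).
    apply: measurable_sqn; apply: measurable_mulmx => i j.
    by have [] := wn_square_integrable zw i j (ltn0Sn k).
  by move=> w; rewrite sqn_ge0 Mle.
- apply: centeredZ; apply: centered_sum => i; apply: centered_sum => l.
  have e w : er k w i l * (M *m zeta k.+1 w) i l =
      \sum_q M i q * (er k w i l * zeta k.+1 w q l).
    by rewrite mxE big_distrr; apply: eq_bigr => q _ /=; rewrite mulrCA.
  under eq_fun do rewrite e.
  by apply: centered_sum => q; apply: centeredZ; apply: error_orth; rewrite k1 ltnSn.
- by move=> w; rewrite -h sqn_ge0.
Qed.

Hypothesis b01 : forall k, (1 <= k)%N -> 0 < b k <= 1.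

(** Both kinds of step sizes lead to a recursion of Chung type.  For
    b k of order k^(-r) the factor (1 - b)^2 is bounded by 1 - b.  In the harmonic
    case a / (k + a1), where a may equal 1, the square is essential:
    (1 - a/m)^2 <= 1 - (3/2)/m for large m, and 3/2 exceeds 1. *)
Lemma error_bound_exists : error_step b ->
  exists c : R, forall k, (1 <= k)%N -> mean_le P (fun w => sqn (er k w)) (c * b k).
Proof.
pose v k := mean P (fun w => sqn (er k w)).
have ev k : (1 <= k)%N -> mean_le P (fun w => sqn (er k w)) (v k).
  elim: k => // -[_ _|k IH _].
    have h : mean_le P (fun w => sqn (er 1 w)) (sqn er1).
      by under eq_fun do rewrite er1E; exact: (mean_le_cst P (sqn_ge0 er1)).
    by have [] := mean_leP h.
  by have [] := mean_leP (error_mean (ltn0Sn k) (IH (ltn0Sn k))).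
have vS k : (1 <= k)%N -> v k.+1 <= (1 - b k) ^+ 2 * v k + b k ^+ 2 * S.
  by move=> k1; have [] := mean_leP (error_mean k1 (ev k k1)).
have v0 k : (1 <= k)%N -> 0 <= v k by move=> k1; exact: mean_le_ge0 (ev k k1).
have S0 : 0 <= S by exact: mean_le_ge0 (wn_mean zw (ltnSn 0)).
suff bnd u : (exists2 D, 0 < D & forall k, (1 <= k)%N -> v k <= D * u k) ->
    (exists2 C, 0 < C & forall k, (1 <= k)%N -> u k <= C * b k) ->
    exists c : R, forall k, (1 <= k)%N -> mean_le P (fun w => sqn (er k w)) (c * b k).
  case=> [[r /andP[r2 r1] [[C1 C10 bC1] [C2 C20 bC2]]]|[a [a1 [a10 /andP[a_ge1 aa1] ba]]]].
    have r0 : 0 < r by apply: lt_trans r2; rewrite invr_gt0.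
    apply: (bnd (inv_pow r)); last by exists C2 => // k /bC2; rewrite lee_fin.
    apply: (@chung_pow _ _ C2^-1 (S * C1) v b 1); rewrite ?r0 ?invr_gt0 // => k k1.
      have /andP[_ ->] := b01 k1; rewrite andbT ler_pdivrMl //.
      by have := bC2 k k1; rewrite lee_fin.
    have /andP[b0 b1] := b01 k1; apply: (le_trans (vS k k1)).
    have h1 : (1 - b k) ^+ 2 * v k <= (1 - b k) * v k.
      rewrite ler_wpM2r ?v0 // expr2 ler_piMr ?subr_ge0 //; lra.
    have h2 : b k ^+ 2 * S <= S * C1 * b k * inv_pow r k.
      have := bC1 k k1; rewrite lee_fin => h.
      have := ler_wpM2l (mulr_ge0 S0 (ltW b0)) h; lra.
    exact: lerD.
  have a0 : 0 < a := lt_le_trans ltr01 a_ge1.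
  have m0 k : (1 <= k)%N -> 0 < k%:R + a1 by move=> k1; rewrite ltr_wpDr // ltr0n.
  apply: (bnd (fun k => (k%:R + a1)^-1)); last first.
    exists a^-1; rewrite ?invr_gt0 // => k k1.
    by rewrite ba // mulrA mulVf ?gt_eqF // mul1r.
  apply: (@chung_harmonic _ (3 / 2) a1 (a ^+ 2 * S) v (maxn 1 (Num.bound (2 * a ^+ 2)))) => //.
    by lra.
  move=> k; rewrite geq_max => /andP[k1 ka].
  have mk := m0 k k1; set m := k%:R + a1 in mk *.
  have am : 2 * a ^+ 2 <= m.
    have h : 0 <= 2 * a ^+ 2 by rewrite mulr_ge0 ?sqr_ge0.
    by rewrite ler_wpDr // (le_trans (ltW (archi_boundP h))) // ler_nat.
  apply: (le_trans (vS k k1)); apply: lerD; last first.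
    by rewrite ba // -/m exprMn exprVn mulrAC.
  rewrite ler_wpM2r ?v0 // ba // -/m.
  have -> : 1 - 3 / 2 / m = (m ^+ 2 - 3 / 2 * m) / m ^+ 2 by field; rewrite gt_eqF.
  have -> : (1 - a / m) ^+ 2 = (m ^+ 2 - 2 * a * m + a ^+ 2) / m ^+ 2.
    by field; rewrite gt_eqF.
  rewrite ler_pM2r ?invr_gt0 ?exprn_gt0 //.
  have := ler_wpM2r (ltW mk) a_ge1; lra.
move=> [D D0 vD] [C C0 uC]; exists (D * C) => k k1.
apply: mean_leW (ev k k1) _; apply: (le_trans (vD k k1)).
by rewrite -mulrA ler_wpM2l ?uC // ltW.
Qed.

End NoiseMoments.

(** * Measurability of the iterates *)

Section Composition.
Context {R : realType} {disp : measure_display} {T : measurableType disp}.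

(** An open set of vectors is a countable union of balls with rational centers
    and radii 1 / (n + 1), and the preimage of a ball of the sup norm is an
    intersection of d measurable events. *)
Lemma measurable_continuous_comp d (g : 'rV[R]_d -> R) (h : T -> 'rV[R]_d) :
  continuous g -> (forall l, measurable_fun setT (fun w => h w 0 l)) ->
  measurable_fun setT (fun w => g (h w)).
Proof.
move=> cg mh.
have mball (c : 'rV[R]_d) (r : R) : 0 < r -> measurable (h @^-1` ball c r).
  move=> r0; rewrite (_ : _ @^-1` _ =
      \bigcap_(l in [set: 'I_d]) [set w | ball (c 0 l) r (h w 0 l)]).
    apply: fin_bigcap_measurable; first exact: finite_finset.
    move=> l _; rewrite -[X in measurable X]setTI.
    by apply: (mh l measurableT (ball (c 0 l) r)); apply: open_measurable; exact: ball_open.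
  apply/seteqP; split=> [w [_ hw] l _|w hw]; first exact: hw.
  by split=> // i l; rewrite ord1; exact: hw.
have mopen (U : set 'rV[R]_d) : open U -> measurable (h @^-1` U).
  move=> oU.
  pose B (q : 'rV[rat]_d * nat) : set 'rV[R]_d :=
    ball (map_mx ratr q.1 : 'rV[R]_d) (q.2.+1%:R^-1 : R).
  have B0 n : 0 < n.+1%:R^-1 :> R by rewrite invr_gt0 ltr0n.
  have -> : h @^-1` U = \bigcup_q if `[< B q `<=` U >] then h @^-1` B q else set0.
    apply/seteqP; split=> w /=; last first.
      by move=> [q _]; case: asboolP => // + Bw; apply.
    move=> Uw; have /nbhs_ballP[r /= r0 rU] := open_nbhs_nbhs (conj oU Uw).
    have r20 : 0 <= 2 / r by rewrite divr_ge0 // ltW.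
    have rn := archi_boundP r20; set n := Num.bound _ in rn.
    have n2 : (n.+1%:R^-1 + n.+1%:R^-1 : R) <= r.
      have -> : n.+1%:R^-1 + n.+1%:R^-1 = 2 / n.+1%:R :> R by ring.
      rewrite ler_pdivrMr ?ltr0n // mulrC -ler_pdivrMr //.
      by rewrite (le_trans (ltW rn)) // ler_nat.
    have /choice[q hq] (l : 'I_d) : exists q : rat, `|ratr q - h w 0 l| < n.+1%:R^-1.
      have [|q] := @rat_in_itvoo R (h w 0 l - n.+1%:R^-1) (h w 0 l + n.+1%:R^-1).
        by rewrite ltrD2l (lt_trans _ (B0 n)) // oppr_lt0 B0.
      by rewrite in_itv /= => /andP[q1 q2]; exists q; rewrite ltr_distl q1 q2.
    have Bw : B (\row_l q l, n) (h w).
      by split=> [|i l]; rewrite ?B0 // ord1 !mxE; exact: hq.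
    exists (\row_l q l, n) => //; case: asboolP => // -[v Bv]; apply: rU.
    apply: le_ball n2 _ _; apply: ball_triangle Bv.
    exact: ball_sym.
  apply: countable_bigcupT_measurable => [|q]; first exact: countableP.
  by case: ifP => // _; exact: mball.
apply: (measurability _ (RGenOpens.measurableE R)).
move=> _ [_ [a [b ->] <-]]; rewrite setTI; apply: (mopen (g @^-1` `]a, b[%classic)).
by move/continuousP: cg; apply; exact: interval_open.
Qed.

End Composition.

Section MeasurableGradient.
Context {R : realType} {d : nat}.

(** Comparison with the sup norm, which defines the topology of vectors. *)
Lemma sqn_le_norm (v : 'rV[R]_d) : sqn v <= d%:R * `|v| ^+ 2.
Proof.
rewrite sqnE big_ord1 -[d in d%:R]card_ord mulr_natl -sumr_const.
apply: ler_sum => l _; rewrite -[leLHS]real_normK ?num_real // lerXn2r ?nnegrE //.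
by rewrite [leRHS]/Num.norm /= mx_normrE; apply: (le_bigmax _ _ (0, l)).
Qed.

Lemma grad_continuous L (g : 'rV[R]_d -> R) l : 0 <= L -> smooth L g ->
  continuous (fun v => grad g v 0 l).
Proof.
move=> L0 gL v; pose C := L * d.+1%:R + 1.
have C0 : 0 < C by rewrite ltr_wpDl // mulr_ge0.
apply/(@cvgrPdist_lt _ _ _ _ (nbhs_filter v)) => e e0; apply/nbhs_ballP; exists (e / C) => /=.
  by rewrite divr_gt0.
move=> u; rewrite -ball_normE /= => uv.
apply: (@le_lt_trans _ _ (C * `|v - u|)); last by rewrite mulrC -ltr_pdivlMr.
rewrite -(@ler_sqr R) ?nnegrE ?mulr_ge0 ?(ltW C0) // real_normK ?num_real //.
have h1 : (grad g v 0 l - grad g u 0 l) ^+ 2 <= sqn (grad g v - grad g u).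
  rewrite sqnE big_ord1 (bigD1 l) //= !mxE lerDl.
  by apply: sumr_ge0 => ? _; exact: sqr_ge0.
apply: (le_trans h1); apply: (le_trans (smooth_sq v u L0 gL)).
apply: (@le_trans _ _ (L ^+ 2 * (d%:R * `|v - u| ^+ 2))).
  by rewrite ler_wpM2l ?sqr_ge0 ?sqn_le_norm.
rewrite exprMn mulrA ler_wpM2r ?sqr_ge0 //.
have -> : C ^+ 2 = L ^+ 2 * d.+1%:R ^+ 2 + 2 * (L * d.+1%:R) + 1 by rewrite /C; ring.
rewrite -addrA ler_wpDr ?addr_ge0 ?mulr_ge0 // ler_wpM2l ?sqr_ge0 //.
by rewrite -natrX ler_nat expnS expn1 mulSn leqW // leq_addr.
Qed.

End MeasurableGradient.

(** * The algorithm and its rates of convergence *)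

Section Analysis.
Context (R : realType) (n d : nat) (disp : measure_display)
    (T : measurableType disp) (P : probability T R)
    (f : 'I_n -> 'rV[R]_d -> R) (L mu : R)
    (e : rel 'I_n) (W : 'M[R]_n) (eta : R)
    (zetas zetax : nat -> T -> 'M[R]_(n, d)) (sigma : R)
    (alpha beta gamma : nat -> R) (tgam c1 : R)
    (x s zs zx : nat -> T -> 'M[R]_(n, d)).
Hypothesis L0 : 0 <= L.
Hypothesis obj : objective_assumption f L mu.
Hypothesis net : network_assumption e W.
Hypothesis Weta : contraction_constant W eta.
Hypothesis noise : noise_assumption P zetas zetax sigma.
Hypothesis tg01 : in_unit tgam.
Hypothesis steps : forall k, (1 <= k)%N ->
     [/\ in_unit (alpha k), in_unit (beta k) & in_unit (gamma k)].
Hypothesis vra : vra_dgt f e W alpha beta gamma tgam zetas zetax x s zs zx.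
Hypothesis c10 : 0 < c1.
Hypothesis gammaE : forall k, (1 <= k)%N -> gamma k = c1 * alpha k.

Let fL : forall i, smooth L (f i). Proof. by case: obj. Qed.
Let fmu : strongly_convex mu (favg f). Proof. by case: obj. Qed.
Let W_ge0 : forall i j, 0 <= W i j. Proof. by case: net. Qed.
Let Wrow : W *m ones n = ones n. Proof. by case: net => _ _ _ []. Qed.
Let Wcol : (ones n)^T *m W = (ones n)^T. Proof. by case: net => _ _ _ []. Qed.
Let n0 : (0 < n)%N.
Proof. by case: net => _ _ _ _ [i _]; exact: leq_ltn_trans (leq0n i) (ltn_ord i). Qed.

Definition sharing_error (z u : nat -> T -> 'M[R]_(n, d)) k w := z k w - offdiag W *m u k w.
Let es := sharing_error zs s.
Let ex := sharing_error zx x.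
Let y k w := s k.+1 w - s k w.

(** The sum over neighbours is a full sum, because the off-diagonal weights
    vanish outside the graph. *)
Lemma received_mulmx b (u zeta : nat -> T -> 'M[R]_(n, d)) k w i : b != 0 ->
  b *: received e W b u zeta k w i =
  row i (offdiag W *m (u k.+1 w - (1 - b) *: u k w + b *: zeta k.+1 w)).
Proof.
move=> b0; have [_ _ We _ _] := net.
rewrite /received scaler_sumr row_mul mulmx_sum_row big_mkcond /=.
apply: eq_bigr => j _; rewrite mxE offdiagE eq_sym.
have [ij|ij] /= := eqVneq i j; first by rewrite scale0r.
case: ifPn => eij; last by have [_ ->] := We i j ij; rewrite ?scale0r.
rewrite scalerA mulrC -scalerA; congr (_ *: _).
rewrite scalerDr scalerA mulfV // scale1r.
by apply/rowP => l; rewrite !mxE.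
Qed.

Lemma diag_mul_row (A : 'M[R]_(n, d)) i :
  W i i *: row i A = row i ((W - offdiag W) *m A).
Proof. by rewrite /offdiag subKr mul_diag_mx; apply/rowP => l; rewrite !mxE. Qed.

Lemma s_step k w : (1 <= k)%N ->
  s k.+1 w = (1 - tgam) *: s k w + tgam *: (W *m s k w) + tgam *: es k w
    + gradmx f (x k w).
Proof.
move=> k1; apply/row_matrixP => i; have [_ /(_ k w i k1)[-> _ _ _]] := vra.
rewrite diag_mul_row -row_gradmx.
have : zs k w + (W - offdiag W) *m s k w = W *m s k w + es k w.
  by rewrite /es /sharing_error mulmxBl addrCA.
move: (W *m s k w) (_ *m s k w) => A B /eqP; rewrite -subr_eq => /eqP <-.
by apply/rowP => l; rewrite !mxE; ring.
Qed.

Lemma x_step k w : (1 <= k)%N ->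
  x k.+1 w = (1 - c1 * alpha k) *: x k w + (c1 * alpha k) *: (W *m x k w)
    + (c1 * alpha k) *: ex k w - alpha k *: y k w.
Proof.
move=> k1; apply/row_matrixP => i; have [_ /(_ k w i k1)[_ -> _ _]] := vra.
rewrite diag_mul_row gammaE //.
have : zx k w + (W - offdiag W) *m x k w = W *m x k w + ex k w.
  by rewrite /ex /sharing_error mulmxBl addrCA.
move: (W *m x k w) (_ *m x k w) => A B /eqP; rewrite -subr_eq => /eqP <-.
by rewrite /y; apply/rowP => l; rewrite !mxE; ring.
Qed.

(** The states u cancel: the error is driven by the noise alone. *)
Lemma sharing_error_step z u zeta : (forall k w i, (1 <= k)%N -> row i (z k.+1 w) =
    (1 - beta k) *: row i (z k w) + beta k *: received e W (beta k) u zeta k w i) ->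
  forall k w, (1 <= k)%N -> sharing_error z u k.+1 w =
    (1 - beta k) *: sharing_error z u k w + beta k *: (offdiag W *m zeta k.+1 w).
Proof.
move=> zE k w k1; have [_ /andP[b0 _] _] := steps k1.
rewrite /sharing_error; have -> : z k.+1 w = (1 - beta k) *: z k w + offdiag W *m
    (u k.+1 w - (1 - beta k) *: u k w + beta k *: zeta k.+1 w).
  apply/row_matrixP => i; rewrite zE // received_mulmx ?gt_eqF //.
  by move: (offdiag W *m _) => A; apply/rowP => l; rewrite !mxE.
rewrite mulmxDr mulmxBr -!scalemxAr.
by apply/matrixP => i l; rewrite !mxE; ring.
Qed.

Lemma es_step k w : (1 <= k)%N ->
  es k.+1 w = (1 - beta k) *: es k w + beta k *: (offdiag W *m zetas k.+1 w).
Proof. by apply: sharing_error_step => k' w' i k1; have [_ /(_ k' w' i k1)[]] := vra. Qed.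

Lemma ex_step k w : (1 <= k)%N ->
  ex k.+1 w = (1 - beta k) *: ex k w + beta k *: (offdiag W *m zetax k.+1 w).
Proof. by apply: sharing_error_step => k' w' i k1; have [_ /(_ k' w' i k1)[]] := vra. Qed.

Lemma vra_iteration k w : (1 <= k)%N ->
  iteration f W tgam c1 (alpha k) (beta k) (x k w) (y k w) (ex k w) (es k w)
    (x k.+1 w) (y k.+1 w) (zetas k.+1 w).
Proof.
move=> k1; split; first exact: x_step.
- rewrite {1}/y s_step // [X in _ - X = _](s_step _ k1) es_step // /y mulmxBr.
  move: (W *m s k.+1 w) (W *m s k w) (offdiag W *m _) => A B C.
  by apply/matrixP => i l; rewrite !mxE; ring.
- rewrite /y {1}s_step // !(avgrowD, avgrowZ, avgrowN) avgrow_gossip //.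
  by apply/rowP => l; rewrite !mxE; ring.
Qed.

Lemma lyapunovE k w : lyapunov f x s k w = merit f (x k w) (y k w).
Proof. by rewrite /lyapunov !fnorm_sq -avgmxE. Qed.


Lemma zetas_white : white_noise P zetas (n%:R * sigma ^+ 2).
Proof.
have [mz cz _ _ bz] := noise.
apply: (@noise_white _ _ _ P n d zetas (filt_x zetas zetax)).
- by move=> k i l; have [] := mz k i l.
- by move=> k; exact: sigma_algebra_setT.
- by move=> t k A tk zA; apply: sub_sigma_algebra; exists t => //; right.
- by move=> k i l k1; have [] := cz k i l k1.
- by move=> k i k1; have [] := bz k i k1.
Qed.

Lemma zetax_white : white_noise P zetax (n%:R * sigma ^+ 2).
Proof.
have [mz cz _ _ bz] := noise.
apply: (@noise_white _ _ _ P n d zetax (filt_s zetas zetax)).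
- by move=> k i l; have [] := mz k i l.
- move=> k; rewrite /filt_s; case: ifP => _; first by right.
  exact: sigma_algebra_setT.
- move=> t k A /andP[t2 tk] zA; rewrite /filt_s ltnNge (leq_trans t2 (ltnW tk)) /=.
  apply: sub_sigma_algebra; left; apply: sub_sigma_algebra.
  by exists t; [rewrite t2|left].
- by move=> k i l k1; have [] := cz k i l k1.
- by move=> k i k1; have [] := bz k i k1.
Qed.

Lemma initial_cst : exists x1 s1 : 'M[R]_(n, d), forall w,
  [/\ x 1 w = x1, zx 1 w = x1, s 1 w = s1 & zs 1 w = s1].
Proof. by have [[x1 [s1 h]] _] := vra; exists x1, s1. Qed.

Lemma es_initial : exists e1, forall w, es 1 w = e1.
Proof.
have [x1 [s1 h]] := initial_cst; exists (s1 - offdiag W *m s1) => w.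
by rewrite /es /sharing_error; have [_ _ -> ->] := h w.
Qed.

Lemma ex_initial : exists e1, forall w, ex 1 w = e1.
Proof.
have [x1 [s1 h]] := initial_cst; exists (x1 - offdiag W *m x1) => w.
by rewrite /ex /sharing_error; have [-> -> _ _] := h w.
Qed.

(** The first increment s_2 - s_1 is computed before any noise arrives. *)
Lemma merit_initial : exists2 m : R, 0 <= m & forall w, merit f (x 1 w) (y 1 w) = m.
Proof.
have [x1 [s1 h]] := initial_cst; have [e1 ee] := es_initial; eexists; last first.
  by move=> w; rewrite /y s_step // ee; have [-> _ -> _] := h w; reflexivity.
exact: (merit_ge0 fmu).
Qed.

Lemma es_measurable k i l : (1 <= k)%N -> measurable_fun setT (fun w => es k w i l).
Proof.
have [e1 ee] := es_initial => k1.
by have [] := error_square_integrable zetas_white ee es_step i l k1.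
Qed.

Lemma ex_measurable k i l : (1 <= k)%N -> measurable_fun setT (fun w => ex k w i l).
Proof.
have [e1 ee] := ex_initial => k1.
by have [] := error_square_integrable zetax_white ee ex_step i l k1.
Qed.

Lemma gradmx_measurable (A : T -> 'M[R]_(n, d)) :
  (forall i l, measurable_fun setT (fun w => A w i l)) ->
  forall i l, measurable_fun setT (fun w => gradmx f (A w) i l).
Proof.
move=> mA i l; under eq_fun do rewrite mxE.
have cg := grad_continuous (l := l) L0 (fL i).
apply: (measurable_continuous_comp (h := fun w => row i (A w)) cg) => m.
by under eq_fun do rewrite mxE; exact: mA.
Qed.

(** The errors are explicit combinations of the noise, so only x and s need an
    induction, with z expressed through the errors. *)
Lemma state_measurable k : (1 <= k)%N ->
  (forall i l, measurable_fun setT (fun w => s k w i l)) /\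
  (forall i l, measurable_fun setT (fun w => x k w i l)).
Proof.
elim: k => // -[_ _|k IH _].
  have [x1 [s1 h]] := initial_cst; split=> i l.
    rewrite (_ : (fun w => _) = cst (s1 i l)) //.
    by apply/funext => w; have [_ _ -> _] := h w.
  rewrite (_ : (fun w => _) = cst (x1 i l)) //.
  by apply/funext => w; have [-> _ _ _] := h w.
have [//|ms mx] := IH; have k1 : (1 <= k.+1)%N by [].
have ms' i l : measurable_fun setT (fun w => s k.+2 w i l).
  under eq_fun do rewrite s_step // mxE [X in X + _]mxE [X in X + _ + _]mxE.
  apply: measurable_funD; last exact: gradmx_measurable.
  apply: measurable_funD; last first.
    by under eq_fun do rewrite mxE; apply: measurable_funM => //; exact: es_measurable.
  apply: measurable_funD; under eq_fun do rewrite mxE; apply: measurable_funM => //.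
  exact: measurable_mulmx.
split=> // i l.
under eq_fun do rewrite x_step // mxE [X in X + _]mxE [X in X + _ + _]mxE.
apply: measurable_funD.
  apply: measurable_funD; last first.
    by under eq_fun do rewrite mxE; apply: measurable_funM => //; exact: ex_measurable.
  apply: measurable_funD; under eq_fun do rewrite mxE; apply: measurable_funM => //.
  exact: measurable_mulmx.
under eq_fun do rewrite -scaleNr mxE.
apply: measurable_funM => //; under eq_fun do rewrite !mxE.
exact: measurable_funB.
Qed.

Lemma deviation_measurable (A : T -> 'M[R]_(n, d)) :
  (forall i l, measurable_fun setT (fun w => A w i l)) ->
  measurable_fun setT (fun w => sqn (deviation (A w))).
Proof.
move=> mA; apply: measurable_sqn => i l; under eq_fun do rewrite /deviation mxE [X in _ + X]mxE.
by apply: measurable_funB => //; exact: measurable_mulmx.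
Qed.

Lemma merit_measurable k : (1 <= k)%N ->
  measurable_fun setT (fun w => merit f (x k w) (y k w)).
Proof.
move=> k1; have [ms mx] := state_measurable k1; have [ms' _] := state_measurable (ltn0Sn k).
apply: measurable_funD.
  apply: measurable_funD; apply: deviation_measurable => // i l.
  by under eq_fun do rewrite !mxE; exact: measurable_funB.
apply: measurable_funB => //.
have cf : continuous (favg f : 'rV[R]_d -> R).
  by move=> v; have [df _] := smooth_favg n0 L0 fL; exact: differentiable_continuous (df v).
apply: (measurable_continuous_comp (h := fun w => avgrow (x k w)) cf) => l.
under eq_fun do rewrite /avgrow mxE summxE.
apply: measurable_funM => //; apply: measurable_sum => i.
by under eq_fun do rewrite mxE; exact: mx.
Qed.

Definition merit_le k r := mean_le P (fun w => merit f (x k w) (y k w)) r.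

Lemma merit_leE k r : merit_le k r -> ('E_P[lyapunov f x s k] <= r%:E)%E.
Proof.
case=> _ _; rewrite (_ : (fun w => _) = lyapunov f x s k) //.
by apply/funext => w; rewrite lyapunovE.
Qed.

Lemma merit_le_of (Y : T -> R) k r : (1 <= k)%N -> mean_le P Y r ->
  (forall w, merit f (x k w) (y k w) <= Y w) -> merit_le k r.
Proof.
move=> k1 Yr mY; apply: mean_le_mono Yr; first exact: merit_measurable.
by move=> w; rewrite (merit_ge0 fmu) mY.
Qed.

Lemma error_bounds_exist : error_step beta -> exists cs cx : R,
  error_bound P W beta s zs cs /\ error_bound P W beta x zx cx.
Proof.
move=> bs; have Wle A := @sqn_offdiag R n W Wrow Wcol W_ge0 d A.
have b01 k : (1 <= k)%N -> 0 < beta k <= 1 by case/steps.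
have [e1 ee1] := es_initial; have [e2 ee2] := ex_initial.
have [cs hs] := error_bound_exists zetas_white Wle ee1 es_step b01 bs.
have [cx hx] := error_bound_exists zetax_white Wle ee2 ex_step b01 bs.
exists cs, cx; split=> k k1.
  by have [_ _] := hs k k1; under [in X in _ -> X]eq_fun do rewrite fnorm_sq.
by have [_ _] := hx k k1; under [in X in _ -> X]eq_fun do rewrite fnorm_sq.
Qed.


Lemma es_mean_le cs k : error_bound P W beta s zs cs -> (1 <= k)%N ->
  mean_le P (fun w => sqn (es k w)) (cs * beta k).
Proof.
move=> bcs k1; split.
- by apply: measurable_sqn => i l; exact: es_measurable.
- by move=> w; exact: sqn_ge0.
- by have := bcs k k1; under [in X in X -> _]eq_fun do rewrite fnorm_sq.
Qed.

Lemma ex_mean_le cx k : error_bound P W beta x zx cx -> (1 <= k)%N ->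
  mean_le P (fun w => sqn (ex k w)) (cx * beta k).
Proof.
move=> bcx k1; split.
- by apply: measurable_sqn => i l; exact: ex_measurable.
- by move=> w; exact: sqn_ge0.
- by have := bcx k k1; under [in X in X -> _]eq_fun do rewrite fnorm_sq.
Qed.

Let eta0 : 0 < eta. Proof. by have [/andP[]] := Weta. Qed.
Let eta1 : eta <= 1. Proof. by have [/andP[]] := Weta. Qed.
Let tg0 : 0 < tgam. Proof. by case/andP: tg01. Qed.
Let tg1 : tgam <= 1. Proof. by case/andP: tg01. Qed.
Let alpha0 k : (1 <= k)%N -> 0 < alpha k. Proof. by case/steps => /andP[]. Qed.
Let alpha1 k : (1 <= k)%N -> alpha k <= 1. Proof. by case/steps => /andP[]. Qed.
Let beta0 k : (1 <= k)%N -> 0 < beta k. Proof. by case/steps => _ /andP[]. Qed.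
Let beta1 k : (1 <= k)%N -> beta k <= 1. Proof. by case/steps => _ /andP[]. Qed.
Let gam01 k : (1 <= k)%N -> 0 < c1 * alpha k <= 1.
Proof. by move=> k1; rewrite -gammaE //; case: (steps k1). Qed.

Local Notation delta := (deltaD n mu tgam eta (alpha 1%N) c1 L).
Local Notation tdelta := (tdeltaD W L tgam eta c1).

(** The second entry of the minimum [deltaD] bounds delta by tgam eta / alpha_1,
    and tgam eta <= 1. *)
Lemma delta_alpha_le1 k : (1 <= k)%N -> alpha k <= alpha 1%N -> delta * alpha k <= 1.
Proof.
move=> k1 ak; have a10 := alpha0 (ltnSn 0).
have d2 : delta <= tgam * eta / alpha 1%N.
  rewrite /deltaD ge_min; apply/orP; right; rewrite ge_min; apply/orP; left.
  by rewrite gerBl divr_ge0 // ltW // mulr_gt0.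
apply: (le_trans (ler_wpM2r (ltW (alpha0 k1)) d2)).
rewrite mulrAC ler_pdivrMr // mul1r; apply: (le_trans _ ak).
by rewrite ler_piMl ?(ltW (alpha0 k1)) // mulr_ile1 // ltW.
Qed.

Section ErrorConstants.
Variables cs cx : R.
Hypothesis bcs : error_bound P W beta s zs cs.
Hypothesis bcx : error_bound P W beta x zx cx.

Lemma cs_ge0 : 0 <= cs.
Proof. by have := mean_le_ge0 (es_mean_le bcs (ltnSn 0)); rewrite pmulr_lge0 // beta0. Qed.

Lemma cx_ge0 : 0 <= cx.
Proof. by have := mean_le_ge0 (ex_mean_le bcx (ltnSn 0)); rewrite pmulr_lge0 // beta0. Qed.

Local Notation tau := (tauD n L tgam eta (alpha 1%N) c1 cs cx).
Local Notation ttau := (ttauD n tgam eta cs sigma).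
Local Notation tX := (@tau_cx R n L eta tgam c1).
Local Notation tS := (@tau_cs R n L eta tgam (alpha 1%N)).

Let tX0 : 0 <= tX.
Proof.
rewrite /tau_cx !addr_ge0 ?divr_ge0 ?mulr_ge0 ?sqr_ge0 ?(ltW c10) ?(ltW eta0) //.
exact: (kappaD_ge0 L Weta tg01).
Qed.

Let tS0 : 0 <= tS.
Proof.
rewrite /tau_cs mulr_ge0 ?addr_ge0 ?divr_ge0 ?mulr_ge0 ?sqr_ge0 ?(ltW tg0) ?(ltW eta0) //.
exact: ltW (alpha0 (ltnSn 0)).
Qed.

Lemma tau_ge0 : 0 <= tau.
Proof. by rewrite -[tau]/(tX * cx + tS * cs) addr_ge0 // mulr_ge0 ?cs_ge0 ?cx_ge0. Qed.

Lemma ttau_ge0 : 0 <= ttau.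
Proof.
apply: mulr_ge0; first by rewrite divr_ge0 ?mulr_ge0 ?(ltW tg0) ?(ltW eta0).
by rewrite addr_ge0 ?cs_ge0 // mulr_ge0 ?sqr_ge0.
Qed.

(** Expectation of [contraction_step].  Since beta <= 1, the error term of order
    beta^3 is absorbed in beta^2. *)
Lemma merit_step k r : (1 <= k)%N -> alpha k <= alpha 1%N ->
  (L + 4 * (L ^+ 2 / (tgam * eta)) * n%:R) * alpha k <= 1 ->
  merit_le k r ->
  merit_le k.+1 ((1 - delta * alpha k + tdelta * alpha k ^+ 2) * r
    + tau * alpha k * beta k + ttau * beta k ^+ 2).
Proof.
move=> k1 ak small mr.
have hex := ex_mean_le bcx k1; have hes := es_mean_le bcs k1.
have hz := wn_mean zetas_white (ltn0Sn k).
have rho0 : 0 <= 1 - delta * alpha k + tdelta * alpha k ^+ 2.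
  rewrite addr_ge0 ?subr_ge0 ?delta_alpha_le1 // mulr_ge0 ?sqr_ge0 //.
  exact: (tdeltaD_ge0 L c1 Weta tg01).
have q0 : 0 <= 4 * tgam / eta * beta k ^+ 2.
  by rewrite mulr_ge0 ?sqr_ge0 // divr_ge0 ?mulr_ge0 ?(ltW tg0) ?(ltW eta0).
have := mean_leD (mean_leD (mean_leZ rho0 mr)
  (mean_leZ (ltW (alpha0 k1)) (mean_leD (mean_leZ tX0 hex) (mean_leZ tS0 hes))))
  (mean_leZ q0 (mean_leD hes hz)).
move=> /(merit_le_of (ltn0Sn k)) h.
apply: (mean_leW (h _)) => [w|].
  apply: (contraction_step n0 L0 fL fmu Wrow Wcol W_ge0 Weta tg01 c10) => //.
  - exact: alpha0.
  - exact: alpha1.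
  - exact: gam01.
  - exact: vra_iteration.
have cb : cs * beta k <= cs by rewrite ler_piMr ?cs_ge0 ?beta1.
have := ler_wpM2l q0 cb.
by rewrite /ttauD -[tau]/(tX * cx + tS * cs); lra.
Qed.

Lemma merit_le_exists k : (1 <= k)%N -> exists r, merit_le k r.
Proof.
elim: k => // -[_ _|k IH _].
  have [m m0 hm] := merit_initial; exists m.
  by apply: (merit_le_of (ltnSn 0) (mean_le_cst P m0)) => w; rewrite hm.
have [//|r mr] := IH.
have [C C0 hC] := crude_step n0 L0 fL fmu Wrow Wcol W_ge0 Weta tg01 c10 (beta k.+1)
  (alpha0 (ltn0Sn k)) (gam01 (ltn0Sn k)).
have h := mean_leZ C0 (mean_leD (mean_leD (mean_leD mr (ex_mean_le bcx (ltn0Sn k)))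
  (es_mean_le bcs (ltn0Sn k))) (wn_mean zetas_white (ltn0Sn k.+1))).
eexists; apply: (merit_le_of (ltn0Sn k.+1) h) => w.
by apply: hC; exact: vra_iteration.
Qed.


Hypothesis delta0 : 0 < delta.

Let v k : R := mean P (fun w => merit f (x k w) (y k w)).

Let merit_v k : (1 <= k)%N -> merit_le k (v k).
Proof. by move=> k1; have [r /mean_leP[]] := merit_le_exists k1. Qed.

Let v_step k : (1 <= k)%N -> alpha k <= alpha 1%N ->
  (L + 4 * (L ^+ 2 / (tgam * eta)) * n%:R) * alpha k <= 1 ->
  v k.+1 <= (1 - delta * alpha k + tdelta * alpha k ^+ 2) * v k
    + tau * alpha k * beta k + ttau * beta k ^+ 2.
Proof.
move=> k1 ak small.
by have /mean_leP[_] := merit_step k1 ak small (merit_v k1).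
Qed.

(** Once the steps are small, the term tdelta alpha^2 costs at most half of the
    contraction delta alpha. *)
Lemma eventual_step c2 : 0 < c2 ->
  (forall k, (1 <= k)%N -> alpha k <= alpha 1%N) ->
  (forall k, (1 <= k)%N -> beta k <= c2 * alpha k) ->
  (forall c, 0 < c -> exists2 K, (1 <= K)%N & forall k, (K <= k)%N -> alpha k <= c) ->
  exists2 K, (1 <= K)%N & forall k, (K <= k)%N ->
    v k.+1 <= (1 - delta / 2 * alpha k) * v k + (tau * c2 + ttau * c2 ^+ 2) * alpha k ^+ 2.
Proof.
move=> c20 a_le b_le a_small.
have K0 : 0 <= L + 4 * (L ^+ 2 / (tgam * eta)) * n%:R.
  by rewrite addr_ge0 // mulr_ge0 // mulr_ge0 // divr_ge0 ?sqr_ge0 // ltW // mulr_gt0.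
set Q := (X in 0 <= X) in K0.
have td0 : 0 <= tdelta := tdeltaD_ge0 L c1 Weta tg01.
(* The first bound gives the smallness condition of merit_step, the second one
   tdelta * alpha <= delta / 2. *)
pose c := Num.min (Q + 1)^-1 (delta / (2 * (tdelta + 1))).
have Q1 : 0 < Q + 1 by rewrite ltr_wpDl.
have td1 : 0 < tdelta + 1 by rewrite ltr_wpDl.
have c0 : 0 < c by rewrite lt_min invr_gt0 Q1 divr_gt0 // mulr_gt0.
have [K K1 hK] := a_small c c0; exists K => // k Kk.
have k1 : (1 <= k)%N := leq_trans K1 Kk.
have a0 := alpha0 k1; have b0 := beta0 k1.
have := hK k Kk; rewrite le_min => /andP[h1 h2].
have small : Q * alpha k <= 1.
  apply: (@le_trans _ _ ((Q + 1) * alpha k)).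
    by rewrite ler_wpM2r ?lerDl // ltW.
  by rewrite mulrC -ler_pdivlMr // mul1r.
have small2 : tdelta * alpha k ^+ 2 <= delta / 2 * alpha k.
  rewrite expr2 mulrA ler_wpM2r ?(ltW a0) //.
  have de : delta / (2 * (tdelta + 1)) = delta / 2 / (tdelta + 1) by rewrite invfM mulrA.
  rewrite de ler_pdivlMr // in h2; apply: le_trans h2.
  by rewrite mulrC ler_wpM2l ?lerDl // ltW.
apply: (le_trans (v_step k1 (a_le k k1) small)).
have v0 : 0 <= v k := mean_le_ge0 (merit_v k1).
have e1 := ler_wpM2r v0 small2.
have e2 := ler_wpM2l (mulr_ge0 tau_ge0 (ltW a0)) (b_le k k1).
have e3 : ttau * beta k ^+ 2 <= ttau * (c2 * alpha k) ^+ 2.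
  rewrite ler_wpM2l ?ttau_ge0 // ler_sqr ?nnegrE ?(ltW b0) ?b_le //.
  by rewrite mulr_ge0 ?(ltW a0) ?(ltW c20).
lra.
Qed.

Lemma rate_power b c2 : 2^-1 < b < 1 -> 0 < c2 -> asymp alpha (inv_pow b) ->
  (forall k, (1 <= k)%N -> alpha k.+1 <= alpha k) ->
  (forall k, (1 <= k)%N -> beta k <= c2 * alpha k) ->
  isO (fun k => 'E_P[lyapunov f x s k.+1]%E) (inv_pow b).
Proof.
move=> /andP[b2 b1] c20 [[C1 C10 aC1] [C2 C20 aC2]] a_dec b_le.
have b0 : 0 < b by apply: lt_trans b2; rewrite invr_gt0.
have a_le k : (1 <= k)%N -> alpha k <= alpha 1%N.
  elim: k => // -[//|k IH _]; apply: (le_trans (a_dec k.+1 _)) => //.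
  exact: IH.
have aC1' k : (1 <= k)%N -> alpha k <= C1 * inv_pow b k by move=> /aC1; rewrite lee_fin.
have aC2' k : (1 <= k)%N -> inv_pow b k <= C2 * alpha k by move=> /aC2; rewrite lee_fin.
have [|K K1 hK] := eventual_step c20 a_le b_le.
  move=> c c0; have [K K1 hK] := inv_pow_small b0 (divr_gt0 c0 C10).
  exists K => // k Kk; apply: (le_trans (aC1' k (leq_trans K1 Kk))).
  by rewrite mulrC -ler_pdivlMr // hK.
set C := tau * c2 + _ in hK.
have C0 : 0 <= C.
  rewrite /C; have := mulr_ge0 tau_ge0 (ltW c20).
  by have := mulr_ge0 ttau_ge0 (sqr_ge0 c2); lra.
have d0 : 0 < delta / 2 by rewrite divr_gt0.
have [||k Kk|k Kk|D D0 hD] := @chung_pow _ b (delta / 2 / C2) (C * C1 / (delta / 2)) v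
  (fun k => delta / 2 * alpha k) K.
- by rewrite b0.
- by rewrite divr_gt0.
- have k1 := leq_trans K1 Kk; apply/andP; split.
    by rewrite -mulrA ler_wpM2l ?(ltW d0) // ler_pdivrMl // aC2'.
  by have := delta_alpha_le1 k1 (a_le k k1); have := mulr_gt0 delta0 (alpha0 k1); lra.
- have k1 := leq_trans K1 Kk; apply: (le_trans (hK k Kk)); rewrite lerD2l.
  have -> : C * C1 / (delta / 2) * (delta / 2 * alpha k) * inv_pow b k =
      C * alpha k * (C1 * inv_pow b k) by field; rewrite gt_eqF.
  by rewrite expr2 mulrA ler_wpM2l ?aC1' // mulr_ge0 // ltW // alpha0.
exists D => // k k1; apply: (le_trans (merit_leE (merit_v (ltn0Sn k)))).
rewrite lee_fin; apply: (le_trans (hD k.+1 (ltn0Sn k))); rewrite ler_wpM2l ?(ltW D0) //.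
rewrite /inv_pow !mul1r lef_pV2 ?posrE ?powR_gt0 ?ltr0n //.
by rewrite ge0_ler_powR ?nnegrE ?(ltW b0) ?ler0n // ler_nat.
Qed.

Lemma rate_harmonic a1 a2 c2 : 0 < a1 -> 2 / delta < a2 -> 1 <= c2 * a2 < a1 + 1 ->
  harmonic_step alpha a2 a1 -> harmonic_step beta (c2 * a2) a1 ->
  isO (fun k => 'E_P[lyapunov f x s k.+1]%E) (fun k => 1 / k%:R).
Proof.
move=> a10 da2 /andP[ca _] aE bE.
have a20 : 0 < a2 by apply: lt_trans da2; rewrite divr_gt0.
have c20 : 0 < c2 by rewrite -(pmulr_lgt0 _ a20) (lt_le_trans ltr01).
have m0 k : (1 <= k)%N -> 0 < k%:R + a1 by move=> k1; rewrite ltr_wpDl.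
have a_le k : (1 <= k)%N -> alpha k <= alpha 1%N.
  move=> k1; rewrite !aE // ler_wpM2l ?(ltW a20) // lef_pV2 ?posrE ?m0 //.
  by rewrite lerD2r ler_nat.
have b_le k : (1 <= k)%N -> beta k <= c2 * alpha k by move=> k1; rewrite aE // bE // mulrA.
have [|K K1 hK] := eventual_step c20 a_le b_le.
  move=> c c0; exists (maxn 1 (Num.bound (a2 / c))); first by rewrite leq_maxl.
  move=> k; rewrite geq_max => /andP[k1 kb].
  rewrite aE // ler_pdivrMr ?m0 // mulrC -ler_pdivrMr // ler_wpDr ?(ltW a10) //.
  rewrite (le_trans (ltW (archi_boundP _))) ?ler_nat //.
  by rewrite divr_ge0 // ltW.
set C := tau * c2 + _ in hK.
have [||D D0 hD] := @chung_harmonic _ (delta / 2 * a2) a1 (C * a2 ^+ 2) v K (ltW a10).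
- by have := ler_wpM2l (ltW delta0) (ltW da2); rewrite ltr_pdivrMr // in da2; lra.
- move=> k Kk; have k1 := leq_trans K1 Kk; apply: (le_trans (hK k Kk)).
  by rewrite (aE k) // exprMn exprVn !mulrA.
exists D => // k k1; apply: (le_trans (merit_leE (merit_v (ltn0Sn k)))).
rewrite lee_fin; apply: (le_trans (hD k.+1 (ltn0Sn k))); rewrite ler_wpM2l ?(ltW D0) //.
rewrite mul1r lef_pV2 ?posrE ?ltr0n ?m0 // ler_wpDr ?(ltW a10) // ler_nat //.
Qed.

(** Let rho be the ratio (4 - delta ta) / (4 - 2 delta ta) >= 1.  Passing from
    beta_k to beta_(k+1) costs at most rho, in the square and hence in beta itself,
    and (1 - delta ta / 2) rho = 1 - delta ta / 4.  The remaining delta ta / 4 of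
    A beta and of B beta^2 is exactly tau ta beta and ttau beta^2. *)
Lemma rate_constant ta : (forall k, (1 <= k)%N -> alpha k = ta) ->
  (ereal_sup [set (beta k ^+ 2 / beta k.+1 ^+ 2)%:E
                      | k in [set k | (1 <= k)%N]]
           <= ((4 - delta * ta) / (4 - 2 * delta * ta))%:E)%E ->
  ta <= Num.min 1 (Num.min (1 / (kappaD L tgam eta * n%:R))
                                 (delta / (2 * tdelta))) ->
  forall k, (1 <= k)%N ->
    ('E_P[lyapunov f x s k.+1] <=
       ((1 - delta * ta / 2) ^+ k)%:E * 'E_P[lyapunov f x s 1%N]
       + (4 * tau / delta * beta k)%:E
       + (4 * ttau / (delta * ta) * beta k ^+ 2)%:E)%E.
Proof.
move=> aE ratio; rewrite !le_min => /and3P[ta1 tak tad].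
have ta0 : 0 < ta by rewrite -(aE 1%N) // alpha0.
have n1 : 1 <= n%:R :> R by rewrite ler1n.
have kap : kappaD L tgam eta = 10 * (L ^+ 2 / (tgam * eta)) + 30 * L ^+ 2.
  by rewrite /kappaD mulrA.
have KL : 0 <= L ^+ 2 / (tgam * eta).
  by rewrite divr_ge0 ?sqr_ge0 // mulr_ge0 // ltW.
(* With K = L^2 / (tgam eta), the bound on ta reads
   (10 K + 30 L^2) n ta <= 1: hence 4 K n ta <= 2/5, and L ta <= 1/2 because
   (L ta)^2 <= L^2 ta. *)
have small : (L + 4 * (L ^+ 2 / (tgam * eta)) * n%:R) * ta <= 1.
  have nk : kappaD L tgam eta * n%:R * ta <= 1.
    have [k0|k0] := eqVneq (kappaD L tgam eta * n%:R) 0; first by rewrite k0 mul0r.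
    rewrite mulrC -ler_pdivlMr // lt_def k0 mulr_ge0 //.
    exact: (kappaD_ge0 L Weta tg01).
  rewrite kap in nk.
  have h0 : 0 <= L ^+ 2 / (tgam * eta) * n%:R * ta.
    by rewrite mulr_ge0 ?(ltW ta0) // mulr_ge0.
  have h1 : L ^+ 2 * ta <= L ^+ 2 * n%:R * ta.
    by rewrite ler_wpM2r ?(ltW ta0) // ler_peMr ?sqr_ge0.
  have h2 : L ^+ 2 * ta ^+ 2 <= L ^+ 2 * ta.
    by rewrite ler_wpM2l ?sqr_ge0 // expr2 ler_piMr // ltW.
  have h3 : L * ta <= 2^-1.
    rewrite -(@ler_sqr R) ?nnegrE ?mulr_ge0 ?(ltW ta0) // exprMn.
    by rewrite exprVn; lra.
  have h4 : 0 <= L ^+ 2 * ta by rewrite mulr_ge0 ?sqr_ge0 // ltW.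
  by lra.
have td2 : tdelta * ta ^+ 2 <= delta / 2 * ta.
  rewrite expr2 mulrA ler_wpM2r ?(ltW ta0) //.
  have [->|t0] := eqVneq tdelta 0; first by rewrite mul0r ltW // divr_gt0.
  have tp : 0 < tdelta by rewrite lt_def t0 (tdeltaD_ge0 L c1 Weta tg01).
  by rewrite mulrC -ler_pdivlMr // -mulrA -invfM.
have dta : delta * ta <= 1 by rewrite -(aE 1%N) // delta_alpha_le1.
have dta0 : 0 < delta * ta by rewrite mulr_gt0.
have step k r : (1 <= k)%N -> merit_le k r -> merit_le k.+1
    ((1 - delta * ta / 2) * r + tau * ta * beta k + ttau * beta k ^+ 2).
  move=> k1 mr; have r0 := mean_le_ge0 mr.
  have ak : alpha k = ta := aE k k1.
  apply: mean_leW (merit_step k1 _ _ mr) _; rewrite ?ak //.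
    by rewrite (aE 1%N).
  have e1 := ler_wpM2r r0 td2; lra.
have [m m_ge0 hm] := merit_initial.
have m1 : merit_le 1 m.
  by apply: (merit_le_of (ltnSn 0) (mean_le_cst P m_ge0)) => w; rewrite hm.
have E1 : ('E_P[lyapunov f x s 1%N])%E = m%:E.
  by rewrite -(expectation_cst P m); congr ('E_P[_])%E; apply/funext => w; rewrite lyapunovE hm.
pose rho := (4 - delta * ta) / (4 - 2 * delta * ta).
have rho1 : 1 <= rho by rewrite /rho ler_pdivlMr; lra.
have rho0 : 0 <= rho := le_trans ler01 rho1.
have b2 k : (1 <= k)%N -> beta k ^+ 2 <= rho * beta k.+1 ^+ 2.
  move=> k1; rewrite -ler_pdivrMr ?exprn_gt0 ?beta0 // -lee_fin.
  by apply: le_trans ratio; apply: ereal_sup_ubound; exists k.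
have rhoE : (1 - delta * ta / 2) * rho = 1 - delta * ta / 4.
  by rewrite /rho; field; rewrite gt_eqF //; lra.
clearbody rho.
have b1 k : (1 <= k)%N -> beta k <= rho * beta k.+1.
  move=> k1; have bk := beta0 (ltn0Sn k).
  rewrite -(@ler_sqr R) ?nnegrE ?mulr_ge0 ?(ltW bk) ?(ltW (beta0 k1)) //.
  apply: (le_trans (b2 k k1)); rewrite exprMn ler_wpM2r ?sqr_ge0 //.
  by rewrite expr2 ler_peMr.
pose A := 4 * tau / delta; pose B := 4 * ttau / (delta * ta).
have A0 : 0 <= A by rewrite /A divr_ge0 ?mulr_ge0 ?tau_ge0 ?(ltW delta0).
have B0 : 0 <= B by rewrite /B divr_ge0 ?(ltW dta0) // mulr_ge0 ?ttau_ge0.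
have tauE : tau * ta = A * (delta * ta / 4) by rewrite /A; field; rewrite gt_eqF.
have ttauE : ttau = B * (delta * ta / 4) by rewrite /B; field; rewrite !gt_eqF.
have rate j : (1 <= j)%N ->
    merit_le j.+1 ((1 - delta * ta / 2) ^+ j * m + A * beta j + B * beta j ^+ 2).
  elim: j => // -[_ _|j IH _].
    apply: mean_leW (step _ _ (ltnSn 0) m1) _; rewrite expr1 tauE {1}ttauE.
    have bb := beta0 (ltnSn 0).
    have e1 : A * (delta * ta / 4) <= A by rewrite ler_piMr //; lra.
    have e2 : B * (delta * ta / 4) <= B by rewrite ler_piMr //; lra.
    by rewrite !lerD // ler_wpM2r ?sqr_ge0 // ltW.
  apply: mean_leW (step _ _ (ltn0Sn j.+1) (IH (ltn0Sn j))) _.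
  have t0 : 0 <= 1 - delta * ta / 2 by lra.
  have e1 := ler_wpM2l (mulr_ge0 t0 A0) (b1 j.+1 (ltn0Sn j)).
  have e2 := ler_wpM2l (mulr_ge0 t0 B0) (b2 j.+1 (ltn0Sn j)).
  have e3 : (1 - delta * ta / 2) * A * (rho * beta j.+2) = A * beta j.+2 * (1 - delta * ta / 4).
    by rewrite -rhoE; ring.
  have e4 : (1 - delta * ta / 2) * B * (rho * beta j.+2 ^+ 2) =
      B * beta j.+2 ^+ 2 * (1 - delta * ta / 4) by rewrite -rhoE; ring.
  have e5 : tau * ta * beta j.+2 = A * (delta * ta / 4) * beta j.+2 by rewrite tauE.
  have e6 : ttau * beta j.+2 ^+ 2 = B * (delta * ta / 4) * beta j.+2 ^+ 2.
    by rewrite {1}ttauE.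
  have e7 := exprS (1 - delta * ta / 2) j.+1.
  by rewrite e5 e6 e7; lra.
move=> k k1; apply: (le_trans (merit_leE (rate k k1))).
by rewrite E1 -EFinM -!EFinD.
Qed.

End ErrorConstants.

End Analysis.

Theorem theorem2 (R : realType) (n d : nat) (disp : measure_display)
    (T : measurableType disp) (P : probability T R)
    (f : 'I_n -> 'rV[R]_d -> R) (L mu : R)
    (e : rel 'I_n) (W : 'M[R]_n) (eta : R)
    (zetas zetax : nat -> T -> 'M[R]_(n, d)) (sigma : R)
    (alpha beta gamma : nat -> R) (tgam c1 : R)
    (x s zs zx : nat -> T -> 'M[R]_(n, d)) :
  objective_assumption f L mu ->
  network_assumption e W ->
  contraction_constant W eta ->
  noise_assumption P zetas zetax sigma ->
  in_unit tgam ->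
  (forall k, (1 <= k)%N ->
     [/\ in_unit (alpha k), in_unit (beta k) & in_unit (gamma k)]) ->
  vra_dgt f e W alpha beta gamma tgam zetas zetax x s zs zx ->
  0 < c1 ->
  (forall k, (1 <= k)%N -> gamma k = c1 * alpha k) ->
  let delta := deltaD n mu tgam eta (alpha 1%N) c1 L in
  let EL := fun k => 'E_P[lyapunov f x s k]%E in
  0 < delta ->
  (error_step beta ->
     exists cs cx : R,
       error_bound P W beta s zs cs /\ error_bound P W beta x zx cx) /\
  forall cs cx : R,
    error_bound P W beta s zs cs ->
    error_bound P W beta x zx cx ->
    [/\
      (* (i) *)
      forall b c2 : R,
        2^-1 < b < 1 -> 0 < c2 ->
        asymp alpha (inv_pow b) ->
        (forall k, (1 <= k)%N -> alpha k.+1 <= alpha k) ->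
        (forall k, (1 <= k)%N -> beta k <= c2 * alpha k) ->
        isO (fun k => EL k.+1) (inv_pow b),
      (* (ii) *)
      forall a1 a2 c2 : R,
        0 < a1 -> 2 / delta < a2 -> 1 <= c2 * a2 < a1 + 1 ->
        harmonic_step alpha a2 a1 ->
        harmonic_step beta (c2 * a2) a1 ->
        isO (fun k => EL k.+1) (fun k => 1 / k%:R)
    & (* (iii) *)
      forall ta : R,
        (forall k, (1 <= k)%N -> alpha k = ta) ->
        error_step beta ->
        (ereal_sup [set (beta k ^+ 2 / beta k.+1 ^+ 2)%:E
                      | k in [set k | (1 <= k)%N]]
           <= ((4 - delta * ta) / (4 - 2 * delta * ta))%:E)%E ->
        ta <= Num.min 1 (Num.min (1 / (kappaD L tgam eta * n%:R))
                                 (delta / (2 * tdeltaD W L tgam eta c1))) ->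
        forall k, (1 <= k)%N ->
          (EL k.+1 <=
             ((1 - delta * ta / 2) ^+ k)%:E * EL 1%N
             + (4 * tauD n L tgam eta (alpha 1%N) c1 cs cx / delta * beta k)%:E
             + (4 * ttauD n tgam eta cs sigma / (delta * ta) * beta k ^+ 2)%:E)%E].
Proof.
move=> obj net Weta noise tg01 steps vra c10 gammaE delta EL delta0.
(* For d = 0 smoothness does not force L >= 0.  The constants depend on L
   through its square, so L may be replaced by its absolute value. *)
have L0 := normr_ge0 L.
have obj' : objective_assumption f `|L| mu.
  by have [fL fmu] := obj; split=> // i; exact: smooth_norm.
have L2 : `|L| ^+ 2 = L ^+ 2 by rewrite real_normK ?num_real.
have kE : kappaD `|L| tgam eta = kappaD L tgam eta by rewrite /kappaD L2.
have dE : deltaD n mu tgam eta (alpha 1%N) c1 `|L| = delta.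
  by rewrite /delta /deltaD L2.
have tdE : tdeltaD W `|L| tgam eta c1 = tdeltaD W L tgam eta c1.
  by rewrite /tdeltaD kE.
have tE cs cx : tauD n `|L| tgam eta (alpha 1%N) c1 cs cx =
    tauD n L tgam eta (alpha 1%N) c1 cs cx by rewrite /tauD kE L2.
split; first exact: (error_bounds_exist net noise steps vra).
move=> cs cx bcs bcx; rewrite -dE in delta0; split.
- move=> b c2 b12 c20 aP a_dec b_le.
  exact: (rate_power L0 obj' net Weta noise tg01 steps vra c10 gammaE bcs bcx delta0 b12 c20).
- move=> a1 a2 c2 a10 da2 ca aE bE; rewrite -dE in da2.
  exact: (rate_harmonic L0 obj' net Weta noise tg01 steps vra c10 gammaE bcs bcx delta0 a10 da2 ca).
- move=> ta aE _; rewrite -dE -kE -tdE -tE => ratio ta_le k k1.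
  exact: (rate_constant L0 obj' net Weta noise tg01 steps vra c10 gammaE bcs bcx delta0 aE ratio).
Qed.
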